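(* If a Hausdorff pseudocompact Abelian topological group contains no infinite compact subsets, then it is Pontryagin reflexive.
   Context: A topological space is pseudocompact if every real-valued continuous function on it is bounded. For a topological Abelian group $G$, $G^\wedge$ denotes the group of continuous homomorphisms $G\to\mathbb{T}$ ($\mathbb{T}$ the circle group) with the compact-open topology, and $\alpha_G\colon G\to G^{\wedge\wedge}$ is the evaluation homomorphism $\alpha_G(x)(\chi)=\chi(x)$. $G$ is Pontryagin reflexive if $\alpha_G$ is a topological isomorphism. *)

(* Defs.v *)
From HB Require Import structures.
From mathcomp Require Import all_boot all_order all_algebra.
From mathcomp Require Import all_classical all_reals all_analysis.
Unset Printing Implicit Defensive.
Import Order.TTheory GRing.Theory Num.Theory.
Import numFieldTopology.Exports numFieldNormedType.Exports.
Local Open Scope classical_set_scope.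
Local Open Scope ring_scope.

Definition pseudocompact (R : realType) (X : topologicalType) : Prop :=
  forall f : X -> R, continuous f -> exists M : R, forall x, `|f x| <= M.

(** The circle group T, realised as the unit circle in R x R (= C),
    with the subspace topology (initial topology of the inclusion). *)
Definition circleT (R : realType) : set (R * R) :=
  [set z | z.1 ^+ 2 + z.2 ^+ 2 = 1].

Definition Torus (R : realType) : topologicalType := (circleT R : Type).

Definition cmul (R : realType) (z w : R * R) : R * R :=
  (z.1 * w.1 - z.2 * w.2, z.1 * w.2 + z.2 * w.1).
Arguments cmul {R}.

Definition is_char (R : realType) (X : topologicalType) (add : X -> X -> X)
    (chi : X -> Torus R) : Prop :=
  continuous chi /\
  forall x y, set_val (chi (add x y)) = cmul (set_val (chi x)) (set_val (chi y)).
Arguments is_char {R X}.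

(** Dual group G^ : continuous characters with the compact-open topology
    (as subspace of the compact-open topology on G -> T). *)
Definition dual_set (R : realType) (G : topologicalZmodType)
  : set {compact-open, G -> Torus R} := is_char (fun x y : G => x + y).

Definition Dual (R : realType) (G : topologicalZmodType) : topologicalType :=
  (dual_set R G : Type).

(** The group law of G^ is the pointwise product; [dual_add_rel c1 c2 c3]
    says c3 = c1 * c2 in G^. *)
Definition dual_add_rel (R : realType) (G : topologicalZmodType)
  (c1 c2 c3 : Dual R G) : Prop :=
  forall x : G, set_val ((set_val c3) x) =
    cmul (set_val ((set_val c1) x)) (set_val ((set_val c2) x)).
Arguments dual_add_rel {R G}.

Definition bidual_set (R : realType) (G : topologicalZmodType)
  : set {compact-open, Dual R G -> Torus R} :=
  fun psi => continuous (psi : Dual R G -> Torus R) /\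
    forall c1 c2 c3 : Dual R G, dual_add_rel c1 c2 c3 ->
      set_val (psi c3) = cmul (set_val (psi c1)) (set_val (psi c2)).

Definition Bidual (R : realType) (G : topologicalZmodType) : topologicalType :=
  (bidual_set R G : Type).

Definition alpha (R : realType) (G : topologicalZmodType) (x : G)
  : Dual R G -> Torus R := fun chi => (set_val chi : G -> Torus R) x.

Definition pontryagin_reflexive (R : realType) (G : topologicalZmodType) : Prop :=
  exists a : G -> Bidual R G,
    (forall x, set_val (a x) = alpha R G x) /\
    (forall x y (chi : Dual R G),
       set_val ((set_val (a (x + y)) : Dual R G -> Torus R) chi) =
       cmul (set_val ((set_val (a x) : Dual R G -> Torus R) chi))
            (set_val ((set_val (a y) : Dual R G -> Torus R) chi))) /\
    bijective a /\ continuous a /\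
    (exists b : Bidual R G -> G, cancel a b /\ cancel b a /\ continuous b).

(* Main.v *)
Require Import Defs.
From HB Require Import structures.
From mathcomp Require Import all_boot all_order all_algebra.
From mathcomp Require Import all_classical all_reals all_analysis.
From mathcomp Require Import ring lra.
Set Implicit Arguments.
Unset Strict Implicit.
Unset Printing Implicit Defensive.
Import Order.TTheory GRing.Theory Num.Theory.
Import numFieldTopology.Exports numFieldNormedType.Exports.
Local Open Scope classical_set_scope.
Local Open Scope ring_scope.

(** In a pseudocompact group a decreasing sequence of nonempty open sets has
    closures with a common point; hence the group is precompact, and its
    topology is generated by its continuous characters.  The latter replaces
    Peter-Weyl: a uniformly continuous function orthogonal to all continuous
    characters, for an invariant mean obtained from Folner boxes, vanishes at 0,
    because its autocorrelation is positive definite and extremal positive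
    definite functions are characters.

    As compact subsets of [G] are finite, [G^] carries the topology of pointwise
    convergence.  Its continuous characters are then the evaluations at points
    of [G]: a character of [G^] orthogonal to all evaluations is orthogonal to
    the trigonometric polynomials peaking at the trivial character.  Finally,
    compact subsets of [G^] are finite: an accumulation point of such a set
    gives a sequence of characters [chi_n] staying away from it at some point
    [z], although every cluster point of [chi_n] agrees with it on nets that
    pseudocompactness makes large enough to reach [z].  So [G^^] is [G] with the
    topology of pointwise convergence on characters, which is that of [G].

    A character of [G] is handled as the pair [(c, s)] of its real and imaginary
    parts. *)

(** * Limits along ultrafilters and invariant means *)

(** A mean is a limit, along an ultrafilter, of averages over finite lists. It is defined on all
    bounded functions, continuous or not, but it is only finitely additive, so it may be exchanged
    with uniform limits only. Precompactness supplies these: pointwise limits of equicontinuous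
    families are uniform. The dual has its own such mean, with division of characters as
    translation.

    Extremality of a positive definite function is obtained by maximising a linear functional with a
    small strictly convex term added. This ignores the topology of the group, so the resulting
    characters may be discontinuous and continuity has to be recovered afterwards.

    Closeness of a character to 1 is measured by [1 - c x], half of the squared distance from 1 in
    the plane. The triangle inequality then carries a factor 2, which accounts for the numerical
    constants 1/2, 1/20 and 1/40. *)

Lemma ultra_cvg_compact (T : Type) (U : set_system T) (UF : UltraFilter U)
    (X : topologicalType) (K : set X) (f : T -> X) :
  compact K -> U (f @^-1` K) -> exists2 p, K p & f @ U --> p.
Proof.
move=> cK UK; have [p [Kp clp]] := cK (f @ U) _ UK.
exists p => // A pA; have [//|UnA] := in_ultra_setVsetC (f @^-1` A) UF.
by have [q []] := clp (~` A) A UnA pA.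
Qed.

Section UltraReal.
Variables (R : realType) (T : Type) (U : set_system T).
Hypothesis UF : UltraFilter U.

Lemma ultra_cvg_bounded (f : T -> R) (M : R) :
  (\forall t \near U, `|f t| <= M) -> cvg (f @ U).
Proof.
move=> bf; have [|p _ fp] :=
  @ultra_cvg_compact _ U UF _ `[- M, M]%classic f (@segment_compact R (- M) M).
  by apply: filterS bf => t /=; rewrite in_itv /= ler_norml.
by apply/cvg_ex; exists p.
Qed.

Lemma ultra_cvg_bound (f : T -> R) (M : R) :
  (forall t, `|f t| <= M) -> cvg (f @ U).
Proof. by move=> bf; apply: (@ultra_cvg_bounded f M); near=> t.
Unshelve. all: by end_near. Qed.

End UltraReal.

Definition bounded_fn (R : realType) (X : Type) (k : X -> R) : Prop :=
  exists M : R, forall x, `|k x| <= M.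

Section Bounded.
Variables (R : realType) (X : Type).
Implicit Types k l : X -> R.

Lemma bounded_fnD k l :
  bounded_fn k -> bounded_fn l -> bounded_fn (fun x => k x + l x).
Proof.
move=> [M kM] [N lN]; exists (M + N) => x.
by rewrite (le_trans (ler_normD _ _)) // lerD.
Qed.

Lemma bounded_fnM k l :
  bounded_fn k -> bounded_fn l -> bounded_fn (fun x => k x * l x).
Proof.
move=> [M kM] [N lN]; exists (M * N) => x.
by rewrite normrM ler_pM.
Qed.

Lemma bounded_fnN k : bounded_fn k -> bounded_fn (fun x => - k x).
Proof. by move=> [M kM]; exists M => x; rewrite normrN. Qed.

Lemma bounded_fnB k l :
  bounded_fn k -> bounded_fn l -> bounded_fn (fun x => k x - l x).
Proof. by move=> bk bl; apply: bounded_fnD => //; exact: bounded_fnN. Qed.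

Lemma bounded_fn_cst (c : R) : bounded_fn (fun _ : X => c).
Proof. by exists `|c|. Qed.

Lemma bounded_fn_comp (Y : Type) k (g : Y -> X) :
  bounded_fn k -> bounded_fn (fun y => k (g y)).
Proof. by move=> [M kM]; exists M. Qed.

Lemma bounded_fn_sum (I : Type) (s : seq I) (k : I -> X -> R) :
  (forall i, bounded_fn (k i)) -> bounded_fn (fun x => \sum_(i <- s) k i x).
Proof.
move=> bk; elim: s => [|i s [M IH]].
  by exists 0 => x; rewrite big_nil normr0.
have [N kN] := bk i; exists (N + M) => x.
by rewrite big_cons (le_trans (ler_normD _ _)) // lerD.
Qed.

End Bounded.

Definition avg (R : realType) (X : Type) (F : seq X) (k : X -> R) : R :=
  (\sum_(x <- F) k x) / (size F)%:R.

Section Avg.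
Variables (R : realType) (X : Type).
Implicit Types (k l : X -> R) (F : seq X).

Lemma avgD F k l : avg F (fun x => k x + l x) = avg F k + avg F l.
Proof. by rewrite /avg big_split /= mulrDl. Qed.

Lemma avgZ F (c : R) k : avg F (fun x => c * k x) = c * avg F k.
Proof. by rewrite /avg -mulr_sumr mulrA. Qed.

Lemma avgN F k : avg F (fun x => - k x) = - avg F k.
Proof. by rewrite /avg sumrN mulNr. Qed.

Lemma avgB F k l : avg F (fun x => k x - l x) = avg F k - avg F l.
Proof. by rewrite avgD avgN. Qed.

Lemma avg_cst F (c : R) : F <> [::] -> avg F (fun => c) = c.
Proof.
move=> F0; rewrite /avg big_const_seq count_predT iter_addr_0.
by rewrite -(mulr_natr c) mulfK // pnatr_eq0; case: F F0.
Qed.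

Lemma avg_ge0 F k : (forall x, 0 <= k x) -> 0 <= avg F k.
Proof. by move=> k0; rewrite divr_ge0 // sumr_ge0. Qed.

Lemma avg_le F k l : (forall x, k x <= l x) -> avg F k <= avg F l.
Proof.
by move=> kl; rewrite -subr_ge0 -avgB avg_ge0 // => x; rewrite subr_ge0.
Qed.

Lemma avg_norm F k (M : R) : 0 <= M -> (forall x, `|k x| <= M) ->
  `|avg F k| <= M.
Proof.
move=> M0 kM; case: F => [|a F]; first by rewrite /avg big_nil mul0r normr0.
have h (c : R) : avg (a :: F) (fun => c) = c by rewrite avg_cst.
rewrite ler_norml -{1}(h (- M)) -{2}(h M).
by apply/andP; split; apply: avg_le => x; move: (kM x); rewrite ler_norml => /andP[].
Qed.

End Avg.

(* [x0] is pushed around by the commuting maps [tau i]; in additive notation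
   [folner [:: i1; ...; ir] n] is the box of all [x0 + \sum_j m_j i_j], [m_j < n]. *)
Section Folner.
Variables (R : realType) (X : Type) (x0 : X) (I : eqType) (tau : I -> X -> X).
Hypothesis tauC : forall i j x, tau i (tau j x) = tau j (tau i x).

Fixpoint folner (s : seq I) (n : nat) : seq X :=
  if s is i :: s' then
    [seq iter j (tau i) x | x <- folner s' n, j <- iota 0 n]
  else [:: x0].

Lemma size_folner s n : size (folner s n) = (n ^ size s)%N.
Proof. by elim: s => //= i s IH; rewrite size_allpairs IH size_iota expnS mulnC. Qed.

Lemma iter_tauC i j m x : iter m (tau i) (tau j x) = tau j (iter m (tau i) x).
Proof. by elim: m => //= m ->; rewrite tauC. Qed.

(** Along the axis [i] each row of [n] points telescopes to its two ends and contributes at most 2.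
    Any other axis cuts the box into copies moved by maps that commute with [tau i], and the
    estimate passes to each copy. *)
Lemma folner_sum_invariant s n i (k : X -> R) : (0 < n)%N -> i \in s ->
  (forall x, `|k x| <= 1) ->
  `|\sum_(x <- folner s n) k (tau i x) - \sum_(x <- folner s n) k x| * n%:R
    <= 2 * (size (folner s n))%:R.
Proof.
move=> n0; elim: s k => //= a s IH k; rewrite in_cons => ias k1.
rewrite size_allpairs size_iota natrM mulrA ler_pM2r ?ltr0n //.
rewrite !big_allpairs_dep /=.
have [->|ia] := eqVneq i a.
  rewrite -sumrB.
  rewrite (eq_bigr (fun x => k (iter n (tau a) x) - k x)); last first.
    move=> x _; rewrite -sumrB.
    rewrite (eq_bigr (fun j => k (iter j.+1 (tau a) x) - k (iter j (tau a) x))) //.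
    rewrite -{1}(subn0 n) -/(index_iota 0 n).
    by rewrite telescope_sumr.
  rewrite (le_trans (ler_norm_sum _ _ _)) //.
  rewrite (@le_trans _ _ (\sum_(x <- folner s n) 2)) //.
    apply: ler_sum => x _; rewrite (le_trans (ler_normB _ _)) //.
    by rewrite -[2]/(1 + 1) lerD.
  by rewrite big_const_seq count_predT iter_addr_0 mulr_natr.
have {}ias : i \in s by move: ias; rewrite (negbTE ia).
rewrite exchange_big /= [X in _ - X]exchange_big /= -sumrB.
rewrite (le_trans (ler_norm_sum _ _ _)) //.
rewrite -(ler_pM2r (_ : 0 < n%:R)) ?ltr0n // mulr_suml.
rewrite (@le_trans _ _ (\sum_(j <- iota 0 n) 2 * (size (folner s n))%:R)) //.
  apply: ler_sum => j _.
  have := IH (fun x => k (iter j (tau a) x)) ias (fun x => k1 _).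
  by under eq_bigr do rewrite iter_tauC.
by rewrite big_const_seq count_predT iter_addr_0 size_iota -(mulr_natr (2 * _)).
Qed.

Lemma folner_ultrafilter : exists U : set_system (seq X), [/\ UltraFilter U,
  (\forall F \near U, F <> [::]) &
  forall i (e : R), 0 < e -> \forall F \near U, forall k : X -> R,
    (forall x, `|k x| <= 1) -> `|avg F (fun x => k (tau i x)) - avg F k| <= e].
Proof.
pose B (sn : seq I * nat) : set (seq X) := [set F | F <> [::] /\
  forall i, i \in sn.1 -> forall k : X -> R, (forall x, `|k x| <= 1) ->
   `|avg F (fun x => k (tau i x)) - avg F k| <= 2 / (sn.2.+1)%:R].
have PB : ProperFilter (filter_from setT B).
  apply: filter_from_proper.
    apply: filter_from_filter; first by exists ([::], 0%N).
    move=> [s n] [t m] _ _; exists (s ++ t, maxn n m) => // F [F0 FB]; split; split => //.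
      move=> i /= ins k k1; rewrite (le_trans (FB i _ k k1)) /= ?mem_cat ?ins //.
      by rewrite ler_pM2l // lef_pV2 ?posrE ?ltr0n // ler_nat ltnS leq_maxl.
    move=> i /= ins k k1; rewrite (le_trans (FB i _ k k1)) /= ?mem_cat ?ins ?orbT //.
    by rewrite ler_pM2l // lef_pV2 ?posrE ?ltr0n // ler_nat ltnS leq_maxr.
  move=> [s n] _; exists (folner s n.+1).
  have F0 : (0 < size (folner s n.+1))%N by rewrite size_folner expn_gt0.
  split; first by move=> E; rewrite E in F0.
  move=> i /= ins k k1; rewrite /avg -mulrBl normrM.
  rewrite [X in _ * X]ger0_norm ?invr_ge0 // ler_pdivrMr ?ltr0n //.
  rewrite mulrAC ler_pdivlMr ?ltr0n //.
  exact: folner_sum_invariant.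
have [U [UU BU]] := ultraFilterLemma PB; exists U; split => //.
  by apply: BU; exists ([::], 0%N) => // F [].
move=> i e e0; have [n ne] : exists n : nat, 2 / n.+1%:R < e.
  exists (Num.bound (2 / e)); rewrite ltr_pdivrMr ?ltr0n //.
  rewrite mulrC -ltr_pdivrMr // (lt_trans (archi_boundP _)) ?ltr_nat //.
  by rewrite divr_ge0 // ltW.
apply: BU; exists ([:: i], n) => // F [_ /(_ i)] /=; rewrite mem_seq1 eqxx => H k k1.
by rewrite (le_trans (H _ k k1)) // ltW.
Qed.

End Folner.

Lemma cvg_sumr (R : realType) (T I : Type) (F : set_system T) (FF : Filter F)
    (s : seq I) (f : I -> T -> R) (a : I -> R) :
  (forall i, f i t @[t --> F] --> a i) ->
  \sum_(i <- s) f i t @[t --> F] --> \sum_(i <- s) a i.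
Proof.
move=> fa; elim: s => [|i s IH].
  under eq_fun do rewrite big_nil; rewrite big_nil; exact: cvg_cst.
under eq_fun do rewrite big_cons; rewrite big_cons; exact: cvgD (fa i) IH.
Qed.

Definition mean (R : realType) (X : Type) (U : set_system (seq X))
  (k : X -> R) : R := lim (avg F k @[F --> U]).

(** The bound holds for all [k] at once. Invariance of the mean would be too weak: [twist_shift]
    uses the bound for a function that itself varies with [F]. *)
Definition almost_invariant (R : realType) (X I : Type) (tau : I -> X -> X)
    (U : set_system (seq X)) : Prop :=
  forall i (e : R), 0 < e -> \forall F \near U, forall k : X -> R,
    (forall x, `|k x| <= 1) -> `|avg F (fun x => k (tau i x)) - avg F k| <= e.
Arguments almost_invariant R {X I}.

Section Mean.
Variables (R : realType) (X I : Type) (tau : I -> X -> X).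
Variable (U : set_system (seq X)).
Hypothesis UU : UltraFilter U.
Hypothesis U0 : \forall F \near U, F <> [::].
Hypothesis Uinv : almost_invariant R tau U.
Implicit Types k l : X -> R.

Lemma cvg_avg k : bounded_fn k -> avg F k @[F --> U] --> mean U k.
Proof.
move=> [M kM]; apply: (@ultra_cvg_bound _ _ U UU _ `|M|) => F.
by apply: avg_norm => // x; rewrite (le_trans (kM x)) // ler_norm.
Qed.

Lemma meanD k l : bounded_fn k -> bounded_fn l ->
  mean U (fun x => k x + l x) = mean U k + mean U l.
Proof.
move=> bk bl; apply: cvg_lim => //; under eq_fun do rewrite avgD.
by apply: cvgD; exact: cvg_avg.
Qed.

Lemma meanZ (c : R) k : bounded_fn k -> mean U (fun x => c * k x) = c * mean U k.
Proof.
move=> bk; apply: cvg_lim => //; under eq_fun do rewrite avgZ.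
by apply: cvgMl_tmp; exact: cvg_avg.
Qed.

Lemma meanN k : bounded_fn k -> mean U (fun x => - k x) = - mean U k.
Proof.
move=> bk; apply: cvg_lim => //; under eq_fun do rewrite avgN.
by apply: cvgN; exact: cvg_avg.
Qed.

Lemma meanB k l : bounded_fn k -> bounded_fn l ->
  mean U (fun x => k x - l x) = mean U k - mean U l.
Proof. by move=> bk bl; rewrite meanD ?meanN //; exact: bounded_fnN. Qed.

Lemma mean_cst (c : R) : mean U (fun => c) = c.
Proof.
apply: cvg_lim => //; apply: cvg_near_cst.
by apply: filterS U0 => F F0; rewrite avg_cst.
Qed.

Lemma mean_ge0 k : bounded_fn k -> (forall x, 0 <= k x) -> 0 <= mean U k.
Proof.
move=> bk k0; apply: (cvgr_to_ge (cvg_avg bk)).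
by near=> F; exact: avg_ge0.
Unshelve. all: by end_near. Qed.

Lemma mean_le k l : bounded_fn k -> bounded_fn l ->
  (forall x, k x <= l x) -> mean U k <= mean U l.
Proof.
move=> bk bl kl; rewrite -subr_ge0 -meanB // mean_ge0 //; first exact: bounded_fnB.
by move=> x; rewrite subr_ge0.
Qed.

Lemma mean_norm k (M : R) : (forall x, `|k x| <= M) -> `|mean U k| <= M.
Proof.
move=> kM; have bk : bounded_fn k by exists M.
rewrite ler_norml -{1}(mean_cst (- M)) -{2}(mean_cst M).
apply/andP; split; (apply: mean_le => //; try exact: bounded_fn_cst);
  by move=> x; have := kM x; rewrite ler_norml => /andP[].
Qed.

Lemma mean_dist k l (e : R) : bounded_fn k -> bounded_fn l ->
  (forall x, `|k x - l x| <= e) -> `|mean U k - mean U l| <= e.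
Proof. by move=> bk bl kl; rewrite -meanB // mean_norm. Qed.

Lemma mean_sum (A : Type) (s : seq A) (k : A -> X -> R) :
  (forall a, bounded_fn (k a)) ->
  mean U (fun x => \sum_(a <- s) k a x) = \sum_(a <- s) mean U (k a).
Proof.
move=> bk; elim: s => [|a s IH].
  by under eq_fun do rewrite big_nil; rewrite big_nil mean_cst.
under eq_fun do rewrite big_cons.
by rewrite big_cons meanD ?IH //; exact: bounded_fn_sum.
Qed.

Lemma avg_almost_invariant i (M e : R) : 0 < e ->
  \forall F \near U, forall k, (forall x, `|k x| <= M) ->
    `|avg F (fun x => k (tau i x)) - avg F k| <= e.
Proof.
move=> e0; pose N := `|M| + 1; have N0 : 0 < N by rewrite ltr_wpDl.
have /Uinv eN : 0 < e / N by rewrite divr_gt0.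
apply: filterS (eN i) => F FeN k kM.
have k1 x : `|N^-1 * k x| <= 1.
  rewrite normrM ger0_norm ?invr_ge0 ?(ltW N0) // mulrC ler_pdivrMr // mul1r.
  by rewrite (le_trans (kM x)) // /N (le_trans (ler_norm M)) // lerDl.
have := FeN _ k1; rewrite !avgZ -mulrBr normrM [`|N^-1|]ger0_norm ?invr_ge0 ?(ltW N0) //.
by rewrite [e / N]mulrC ler_pM2l // invr_gt0.
Qed.

Lemma mean_invariant i k : bounded_fn k -> mean U (fun x => k (tau i x)) = mean U k.
Proof.
move=> bk; have bk' := bounded_fn_comp (tau i) bk.
apply/eqP; rewrite -subr_eq0 -normr_le0; apply/ler_addgt0Pl => e e0; rewrite addr0.
have cB : `|avg F (fun x => k (tau i x)) - avg F k| @[F --> U] -->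
    `|mean U (fun x => k (tau i x)) - mean U k|.
  by apply: cvg_norm; apply: cvgB; exact: cvg_avg.
apply: (cvgr_to_le cB).
by case: bk => M kM; apply: filterS (avg_almost_invariant i M e0) => F; apply.
Qed.

End Mean.

(** * Positive definite functions and characters *)

Definition posdef (R : realType) (Z : zmodType) (w : Z -> R) : Prop :=
  forall s : seq (R * Z),
    0 <= \sum_(p <- s) \sum_(q <- s) p.1 * q.1 * w (p.2 - q.2).

(* A complex-valued function [u + i v] on [G] is encoded as the real function
   [w (x, n) = Re (i^n (u + i v) x)] on [Z = G * 'Z_4]; with [J = (0, 1)] it
   satisfies [w (x + 2 J) = - w x]. *)
Definition pdcone (R : realType) (Z : zmodType) (J : Z) (w : Z -> R) : Prop :=
  [/\ posdef w, forall x, w (- x) = w x & forall x, w (x + J + J) = - w x].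

Definition rchar (R : realType) (G : zmodType) (c s : G -> R) : Prop :=
  [/\ forall x y, c (x + y) = c x * c y - s x * s y,
      forall x y, s (x + y) = s x * c y + c x * s y &
      forall x, c x ^+ 2 + s x ^+ 2 = 1].

Section PositiveDefinite.
Variables (R : realType) (Z : zmodType) (J : Z).
Implicit Types w : Z -> R.

Lemma posdef_norm w : posdef w -> (forall x, w (- x) = w x) ->
  forall x, `|w x| <= w 0.
Proof.
move=> pw ew x; have := pw [:: (1, 0); (1, x)]; have := pw [:: (1, 0); (-1, x)].
rewrite !big_cons !big_nil /= !subr0 sub0r ew subrr => h1 h2.
by rewrite ler_norml; apply/andP; split; lra.
Qed.

(** Test [w] on the points of [s] together with their translates by [a], the latter weighted by [e]:
    the four blocks add up to twice the form of the new function. *)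
Lemma posdef_perturb w (a : Z) (e : R) : e ^+ 2 = 1 -> posdef w ->
  posdef (fun x => w x + e * ((w (x + a) + w (x - a)) / 2)).
Proof.
move=> e2 pw s.
have := pw (s ++ [seq (e * p.1, p.2 + a) | p <- s]).
rewrite big_cat /= big_map /=.
under eq_bigr do rewrite big_cat big_map /=.
under [X in _ + X]eq_bigr do rewrite big_cat big_map /=.
rewrite -big_split /=.
set A := \sum_(i <- s) _; set B := \sum_(i <- s) _ => A0.
suff AB : A = 2 * B by move: A0; rewrite AB pmulr_rge0.
rewrite /A /B mulr_sumr; apply: eq_bigr => p _.
rewrite -!big_split /= mulr_sumr; apply: eq_bigr => q _.
have -> : p.2 - (q.2 + a) = p.2 - q.2 - a by rewrite opprD addrA.
have -> : p.2 + a - q.2 = p.2 - q.2 + a by rewrite addrAC.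
have -> : p.2 + a - (q.2 + a) = p.2 - q.2 by rewrite opprD addrACA subrr addr0.
have -> : e * p.1 * (e * q.1) = e ^+ 2 * (p.1 * q.1) by ring.
by rewrite e2; field.
Qed.

Lemma pdcone_perturb w (a : Z) (e : R) : e ^+ 2 = 1 -> pdcone J w ->
  pdcone J (fun x => w x + e * ((w (x + a) + w (x - a)) / 2)).
Proof.
move=> e2 [pw ew Jw]; split; first exact: posdef_perturb.
- move=> x; rewrite ew -(ew (- x + a)) -(ew (- x - a)) !opprD !opprK.
  by rewrite [w (x - a) + _]addrC.
- move=> x; rewrite Jw.
  have -> : x + J + J + a = x + a + J + J by rewrite !(addrAC _ _ a).
  have -> : x + J + J - a = x - a + J + J by rewrite !(addrAC _ _ (- a)).
  by rewrite !Jw; ring.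
Qed.

Lemma pdconeZ w (t : R) : 0 <= t -> pdcone J w -> pdcone J (fun x => t * w x).
Proof.
move=> t0 [pw ew Jw]; split => [s|x|x]; last 2 first.
- by rewrite ew.
- by rewrite Jw mulrN.
under eq_bigr do [under eq_bigr do rewrite mulrCA; rewrite -mulr_sumr].
by rewrite -mulr_sumr mulr_ge0.
Qed.

Lemma pdcone_cvg (T : Type) (U : set_system T) (UF : ProperFilter U)
    (v : T -> Z -> R) w :
  (\forall t \near U, pdcone J (v t)) -> (forall x, v t x @[t --> U] --> w x) -> pdcone J w.
Proof.
move=> pv vw; split.
- move=> s.
  have cs : \sum_(p <- s) \sum_(q <- s) p.1 * q.1 * v t (p.2 - q.2) @[t --> U] -->
      \sum_(p <- s) \sum_(q <- s) p.1 * q.1 * w (p.2 - q.2).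
    by do 2 (apply: cvg_sumr => ?); apply: cvgMl_tmp; exact: vw.
  by apply: (cvgr_to_ge cs); apply: filterS pv => t [+ _ _]; apply.
- move=> x; apply/esym/(cvg_unique (@Rhausdorff R) (vw x)).
  apply: cvg_trans (vw (- x)); apply: near_eq_cvg.
  by apply: filterS pv => t [_ + _]; apply.
- move=> x; apply: (cvg_unique (@Rhausdorff R) (vw (x + J + J))).
  apply: cvg_trans (cvgN (vw x)); apply: near_eq_cvg.
  by apply: filterS pv => t [_ _ +] => /(_ x) /esym.
Qed.

Section Maximum.
Variables (l : seq (R * Z)) (S : seq Z) (eta : R).
Hypothesis eta0 : 0 < eta.

(** A maximiser of the linear part alone may be a proper convex combination; the strictly convex
    square term excludes this as far as the points of [S] can tell. *)
Definition pd_objective w : R :=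
  \sum_(p <- l) p.1 * w p.2 + eta * \sum_(x <- S) w x ^+ 2.

Lemma pd_objective_max w0 : pdcone J w0 -> w0 0 = 1 ->
  exists w, [/\ pdcone J w, w 0 = 1 &
    forall v, pdcone J v -> v 0 = 1 -> pd_objective v <= pd_objective w].
Proof.
move=> pw0 w01; pose E := [set pd_objective v | v in [set v | pdcone J v /\ v 0 = 1]].
have nv (v : Z -> R) : pdcone J v -> v 0 = 1 -> forall x, `|v x| <= 1.
  by move=> [pv ev _] v1 x; rewrite -v1; exact: posdef_norm.
have E0 : E !=set0 by exists (pd_objective w0), w0.
have supE : has_sup E.
  split => //; exists (\sum_(p <- l) `|p.1| + eta * \sum_(x <- S) 1).
  move=> _ [v [pv v1] <-]; apply: lerD.
    apply: ler_sum => p _; rewrite (le_trans (ler_norm _)) // normrM.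
    by rewrite ler_piMr // nv.
  rewrite ler_pM2l //; apply: ler_sum => x _.
  by rewrite -real_normK ?num_real // expr_le1 // nv.
have /choice [v vP] : forall n : nat, exists v,
    [/\ pdcone J v, v 0 = 1 & sup E - n.+1%:R^-1 < pd_objective v].
  move=> n; have /sup_adherent := supE => /(_ n.+1%:R^-1).
  by case=> [|_ [v [? ?] <-] ?]; [rewrite invr_gt0 ltr0n | exists v].
have [U [UU ooU]] := ultraFilterLemma (eventually_filter).
have cv x : cvg (v n x @[n --> U]).
  by apply: (@ultra_cvg_bound _ _ U UU _ 1) => n; case: (vP n) => ? ? _; exact: nv.
pose w x := lim (v n x @[n --> U]).
have pw : pdcone J w.
  by apply: (@pdcone_cvg _ U _ v) => //; near=> n; case: (vP n).
have w1 : w 0 = 1.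
  apply: cvg_lim => //; apply: cvg_near_cst; near=> n; by case: (vP n).
exists w; split => // u pu u1; apply: (@le_trans _ _ (sup E)).
  by apply: sup_upper_bound => //; exists u.
have cw : pd_objective (v n) @[n --> U] --> pd_objective w.
  apply: cvgD; first by apply: cvg_sumr => p; apply: cvgMl_tmp; exact: cv.
  apply: cvgMl_tmp; apply: cvg_sumr => x; under eq_fun do rewrite expr2.
  by rewrite expr2; apply: cvgM; exact: cv.
rewrite -subr_ge0; apply/ler_addgt0Pr => e e0.
rewrite addrAC subr_ge0; apply: (cvgr_to_ge (cvgD cw (cvg_cst e))).
apply: ooU; have := near_infty_natSinv_lt (PosNum e0); apply: filterS => n /= ne.
by case: (vP n) => _ _ sE; rewrite -lerBlDr (le_trans _ (ltW sE)) // lerB // ltW.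
Unshelve. all: by end_near. Qed.

(* At a maximiser [w], moving in the directions [w + d] and [w - d], where
   [d x = (w (x + a) + w (x - a)) / 2], stays in the cone; strict convexity of
   the quadratic term then forces [d = w a * w] on [S]. *)
Lemma pd_max_dalembert w : pdcone J w -> w 0 = 1 ->
  (forall v, pdcone J v -> v 0 = 1 -> pd_objective v <= pd_objective w) ->
  forall x a, x \in S -> w (x + a) + w (x - a) = 2 * w a * w x.
Proof.
move=> pw w1 mw x a xS.
pose d y := (w (y + a) + w (y - a)) / 2.
have [pd ew _] := pw; have wa := posdef_norm pd ew a.
have pp := pdcone_perturb a (expr1n R 2) pw.
have pm := pdcone_perturb a (_ : (-1) ^+ 2 = 1 :> R) pw.
rewrite sqrrN expr1n in pm; have {}pm := pm erefl.
have d0 : d 0 = w a by rewrite /d add0r sub0r ew; field.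
suff dx : d x = w a * w x by rewrite /d in dx; lra.
(* If [w a] is 1 or -1, then [w - d] or [w + d] vanishes at 0, hence everywhere, and cannot be
   normalised; the claim is then immediate. *)
have [a1|a1] := eqVneq (w a) 1.
  have [q eq _] := pm; have := posdef_norm q eq x.
  rewrite -/(d x) -/(d 0) d0 w1 a1 !mulN1r subrr normr_le0 => /eqP; lra.
have [am1|am1] := eqVneq (w a) (-1).
  have [q eq _] := pp; have := posdef_norm q eq x.
  rewrite -/(d x) -/(d 0) d0 w1 am1 !mul1r subrr normr_le0 => /eqP; lra.
have cp : 0 < 1 + w a.
  by move: wa; rewrite w1 ler_norml => /andP[h _]; rewrite lt_def; apply/andP;
    split; [apply: contra_neq am1; lra | lra].
have cm : 0 < 1 - w a.
  by move: wa; rewrite w1 ler_norml => /andP[_ h]; rewrite lt_def; apply/andP;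
    split; [apply: contra_neq a1; lra | lra].
(* Normalising [w + d] and [w - d] at 0 gives [w + t * e] with [t = (1 + w a)^-1] and
   [t = - (1 - w a)^-1]. As the signs differ, the linear coefficient [B] cancels between the two
   inequalities, which forces [E = 0]. *)
pose e y := d y - w a * w y.
pose B := \sum_(p <- l) p.1 * e p.2 + 2 * eta * \sum_(y <- S) w y * e y.
pose E := \sum_(y <- S) e y ^+ 2.
have move_e (t : R) : pd_objective (fun y => w y + t * e y) =
    pd_objective w + t * B + eta * t ^+ 2 * E.
  rewrite /pd_objective /B /E.
  under eq_bigr do rewrite mulrDr mulrCA.
  rewrite big_split /= -mulr_sumr.
  under [X in eta * X]eq_bigr => y _.
    rewrite (_ : _ ^+ 2 = w y ^+ 2 + (2 * t * (w y * e y) + t ^+ 2 * e y ^+ 2)); last by ring.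
    over.
  rewrite !big_split /= -!mulr_sumr; ring.
have hp : B + eta * (1 + w a)^-1 * E <= 0.
  have := mw _ (pdconeZ (ltW (_ : 0 < (1 + w a)^-1)) pp).
  rewrite invr_gt0 => /(_ cp); rewrite -/(d 0) d0 w1 mul1r mulVf ?gt_eqF // => /(_ erefl).
  rewrite (_ : (fun _ => _) = (fun y => w y + (1 + w a)^-1 * e y)); last first.
    apply/funext => y; rewrite /e -/(d y); field; exact: lt0r_neq0.
  rewrite move_e => h; have {h} : (1 + w a)^-1 * (B + eta * (1 + w a)^-1 * E) <= 0 by lra.
  by rewrite pmulr_rle0 ?invr_gt0.
have hm : - B + eta * (1 - w a)^-1 * E <= 0.
  have := mw _ (pdconeZ (ltW (_ : 0 < (1 - w a)^-1)) pm).
  rewrite invr_gt0 => /(_ cm); rewrite -/(d 0) d0 w1 !mulN1r mulVf ?gt_eqF // => /(_ erefl).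
  rewrite (_ : (fun _ => _) = (fun y => w y + (- (1 - w a)^-1) * e y)); last first.
    apply/funext => y; rewrite /e -/(d y); field; exact: lt0r_neq0.
  rewrite move_e => h; have {h} : (1 - w a)^-1 * (- B + eta * (1 - w a)^-1 * E) <= 0 by lra.
  by rewrite pmulr_rle0 ?invr_gt0.
have E0 : 0 <= E by apply: sumr_ge0 => y _; exact: sqr_ge0.
have E00 : E = 0.
  apply/eqP; rewrite eq_le E0 andbT.
  have k0 : 0 < eta * (1 + w a)^-1 + eta * (1 - w a)^-1.
    by rewrite addr_gt0 // mulr_gt0 // invr_gt0.
  by rewrite -(pmulr_rle0 _ k0); lra.
have : e x ^+ 2 <= E.
  by rewrite /E (big_rem x) //= lerDl sumr_ge0 // => y _; exact: sqr_ge0.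
rewrite E00 => ex; have : e x ^+ 2 == 0 by rewrite eq_le ex sqr_ge0.
by rewrite sqrf_eq0 /e subr_eq0 => /eqP.
Qed.

End Maximum.

(** With [eta = e / (size S).+1] the square term stays below [e] whatever [S] is, since [w] is
    bounded by 1. The solutions for finite [S] can therefore be passed to the limit along an
    ultrafilter of growing [S]. *)
Lemma pdcone_dalembert (l : seq (R * Z)) (e : R) w0 : 0 < e ->
  pdcone J w0 -> w0 0 = 1 ->
  exists w, [/\ pdcone J w, w 0 = 1,
    forall x a, w (x + a) + w (x - a) = 2 * w a * w x &
    \sum_(p <- l) p.1 * w0 p.2 - e <= \sum_(p <- l) p.1 * w p.2].
Proof.
move=> e0 pw0 w01.
have /choice [v vP] : forall S : seq Z, exists w, [/\ pdcone J w, w 0 = 1,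
    forall x a, x \in S -> w (x + a) + w (x - a) = 2 * w a * w x &
    \sum_(p <- l) p.1 * w0 p.2 - e <= \sum_(p <- l) p.1 * w p.2].
  move=> S; pose eta := e / (size S).+1%:R.
  have eta0 : 0 < eta by rewrite divr_gt0 // ltr0n.
  have [w [pw w1 mw]] := pd_objective_max l S eta0 pw0 w01.
  exists w; split => //; first exact: (pd_max_dalembert eta0 pw w1 mw).
  have := mw _ pw0 w01; rewrite /pd_objective.
  have q0 : 0 <= \sum_(x <- S) w0 x ^+ 2 by apply: sumr_ge0 => x _; exact: sqr_ge0.
  have q1 : \sum_(x <- S) w x ^+ 2 <= (size S).+1%:R.
    apply: (@le_trans _ _ (\sum_(x <- S) 1)).
      apply: ler_sum => x _; rewrite -real_normK ?num_real // expr_le1 //.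
      by have [q eq _] := pw; rewrite -w1; exact: posdef_norm.
    by rewrite big_const_seq count_predT iter_addr_0 ler_nat.
  have : eta * \sum_(x <- S) w x ^+ 2 <= e.
    by rewrite /eta mulrAC ler_pdivrMr ?ltr0n // ler_pM2l.
  have : 0 <= eta * \sum_(x <- S) w0 x ^+ 2 by rewrite mulr_ge0 // ltW.
  by lra.
pose B (S0 : seq Z) : set (seq Z) := [set S : seq Z | {subset S0 <= S}].
have PB : ProperFilter (filter_from setT B).
  apply: filter_from_proper; last by move=> S _; exists S => x.
  apply: filter_from_filter; first by exists [::].
  move=> S T _ _; exists (S ++ T) => // V STV; split => x xS; apply: STV;
    by rewrite mem_cat xS ?orbT.
have [U [UU BU]] := ultraFilterLemma PB.
have cv x : cvg (v n x @[n --> U]).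
  apply: (@ultra_cvg_bound _ _ U UU _ 1) => S; case: (vP S) => [[p ev _] <- _ _].
  exact: posdef_norm.
pose w x := lim (v n x @[n --> U]).
exists w; split.
- by apply: (@pdcone_cvg _ U _ v) => //; near=> n; case: (vP n).
- by apply: cvg_lim => //; apply: cvg_near_cst; near=> n; case: (vP n).
- move=> x a; apply: (@cvg_unique _ (@Rhausdorff R) (v S (x + a) + v S (x - a) @[S --> U]) _).
    by apply: cvgD; exact: cv.
  have : 2 * v S a * v S x @[S --> U] --> 2 * w a * w x.
    by apply: cvgM; [apply: cvgMl_tmp|]; exact: cv.
  apply: cvg_trans; apply: near_eq_cvg.
  apply: BU; exists [:: x] => // S xS; case: (vP S) => _ _ + _ => /(_ x a) -> //.
  by apply: xS; rewrite mem_seq1.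
- have cl : \sum_(p <- l) p.1 * v S p.2 @[S --> U] --> \sum_(p <- l) p.1 * w p.2.
    by apply: cvg_sumr => p; apply: cvgMl_tmp; exact: cv.
  by apply: (cvgr_to_ge cl); near=> S; case: (vP S).
Unshelve. all: by end_near. Qed.

(** The functional equation of the cosine does not determine the sign of the sine. The quarter turn
    [J] does: [w (x - J)] is the real part of [-i] times the complex value at [x], that is, its
    imaginary part. *)
Lemma dalembert_rchar w : pdcone J w -> w 0 = 1 ->
  (forall x a, w (x + a) + w (x - a) = 2 * w a * w x) ->
  rchar w (fun x => w (x - J)).
Proof.
move=> [_ ew Jw] w1 dw.
have Jw' x : w (x + J) = - w (x - J) by rewrite -[in LHS](subrK J x) Jw.
have cD x y : w (x + y) = w x * w y - w (x - J) * w (y - J).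
  (* As [w (x - y + J + J) = - w (x - y)], this instance gives [w (x + y) - w (x - y)]; adding
     [dw x y] isolates [w (x + y)]. *)
  have := dw (x + J) (y - J).
  have -> : x + J + (y - J) = x + y by rewrite addrACA subrr addr0.
  have -> : x + J - (y - J) = x - y + J + J by rewrite opprB addrA addrAC (addrAC x J).
  by rewrite Jw Jw'; have := dw x y; lra.
have sN x : w (- x - J) = - w (x - J) by rewrite -ew opprD !opprK Jw'.
split => [//|x y|x].
  have -> : x + y - J = x + (y - J) by rewrite addrA.
  rewrite cD; have -> : w (y - J - J) = - w y by rewrite -[in RHS](subrK J y) -[y - J in RHS](subrK J) Jw opprK.
  by ring.
by have := cD x (- x); rewrite subrr w1 ew sN; lra.
Qed.

End PositiveDefinite.

Section ExistsCharacter.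
Variables (R : realType) (G : zmodType).

(** A finite form of Bochner's theorem: [phi] is a limit of convex combinations of real parts of
    characters, so a linear functional of finitely many values is nearly as large at some character.
    That character may be discontinuous. *)
Lemma posdef_rchar (phi : G -> R) (l : seq (R * G)) (e : R) : 0 < e ->
  posdef phi -> (forall x, phi (- x) = phi x) -> phi 0 = 1 ->
  exists c s : G -> R, rchar c s /\
    \sum_(p <- l) p.1 * phi p.2 - e <= \sum_(p <- l) p.1 * c p.2.
Proof.
move=> e0 pphi ephi phi1.
pose Z := (G * 'Z_4)%type; pose J : Z := (0, 1).
pose re (n : 'Z_4) : R := nth 0 [:: 1; 0; -1; 0] n.
pose im (n : 'Z_4) : R := nth 0 [:: 0; 1; 0; -1] n.
have reN n : re (- n) = re n by case: n => [[|[|[|[|]]]]] //.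
have reJ n : re (n + 1 + 1) = - re n.
  by case: n => [[|[|[|[|]]]]] //= ?; rewrite /re /= ?oppr0 ?opprK.
have reB m n : re (m - n) = re m * re n + im m * im n.
  by case: m => [[|[|[|[|]]]]] // ?; case: n => [[|[|[|[|]]]]] // ?; rewrite /re /im /=; lra.
pose w0 (z : Z) : R := phi z.1 * re z.2.
have pw0 : pdcone J w0.
  split; last 2 first.
  - by move=> [x n]; rewrite /w0 /= ephi reN.
  - by move=> [x n]; rewrite /w0 /= !addr0 reJ mulrN.
  (* By [reB] the form of [w0] is a sum of two forms of [phi], with weights multiplied by [re] and
     by [im]. *)
  move=> s; rewrite (_ : \sum_(p <- s) _ =
    (\sum_(p <- [seq (p.1 * re p.2.2, p.2.1) | p <- s])
      \sum_(q <- [seq (p.1 * re p.2.2, p.2.1) | p <- s]) p.1 * q.1 * phi (p.2 - q.2)) +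
    (\sum_(p <- [seq (p.1 * im p.2.2, p.2.1) | p <- s])
      \sum_(q <- [seq (p.1 * im p.2.2, p.2.1) | p <- s]) p.1 * q.1 * phi (p.2 - q.2))).
    by rewrite addr_ge0.
  rewrite !big_map -big_split /=; apply: eq_bigr => p _.
  rewrite !big_map -big_split /=; apply: eq_bigr => q _.
  by rewrite /w0 /= reB; ring.
have [] := @pdcone_dalembert R Z J [seq (p.1, (p.2, 0) : Z) | p <- l] e w0 e0 pw0.
  by rewrite /w0 /= phi1 mul1r.
move=> w [pw w1 dw]; rewrite !big_map /=.
under eq_bigr do rewrite /w0 /= mulr1.
move=> lw; have [cD sD cs1] := dalembert_rchar pw w1 dw.
exists (fun x => w (x, 0)), (fun x => w ((x, 0) - J)); split => //; split.
- by move=> x y; rewrite -cD /= ; congr w; rewrite -[RHS]/(x + y, 0 + 0) addr0.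
- by move=> x y; rewrite -sD /= ; congr (w (_ - _)); rewrite -[RHS]/(x + y, 0 + 0) addr0.
- by move=> x; rewrite cs1.
Qed.

End ExistsCharacter.

(** * Pseudocompact topological groups *)

Definition ucont (R : realType) (G : topologicalZmodType) (h : G -> R) : Prop :=
  forall e : R, 0 < e -> \forall v \near (0 : G), forall x, `|h (x + v) - h x| <= e.

Definition precompact_group (G : topologicalZmodType) : Prop :=
  forall V : set G, nbhs 0 V ->
    exists s : seq G, forall x, exists2 y, y \in s & V (x - y).

Section TopologicalGroup.
Variables (R : realType) (G : topologicalZmodType).

Lemma nbhs_subr (x : G) (V : set G) : nbhs 0 V -> \forall y \near x, V (y - x).
Proof.
move=> V0; have cx : (y - x) @[y --> x] --> x - x.
  apply: (@continuous_comp _ _ _ (fun y => (y, x)) (fun p : G * G => p.1 - p.2)).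
    by apply: cvg_pair => /=; [exact: cvg_id|exact: cvg_cst].
  exact: sub_continuous.
by apply: cx; rewrite subrr.
Qed.

Lemma nbhs_addl (x : G) (V : set G) : nbhs x V -> \forall v \near (0 : G), V (x + v).
Proof.
move=> Vx; have cx : (x + v) @[v --> (0 : G)] --> x + 0.
  apply: (@continuous_comp _ _ _ (fun v => (x, v)) (fun p : G * G => p.1 + p.2)).
    by apply: cvg_pair => /=; [exact: cvg_cst|exact: cvg_id].
  exact: add_continuous.
by apply: cx; rewrite addr0.
Qed.

Lemma nbhs0_sub (V : set G) : nbhs 0 V ->
  exists2 W : set G, nbhs 0 W & forall x y, W x -> W y -> V (x - y).
Proof.
move=> V0; have := @sub_continuous G (0, 0) V; rewrite /= subr0 => /(_ V0).
case=> -[A B] /= [A0 B0] AB; exists (A `&` B); first exact: filterI.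
by move=> x y [Ax _] [_ By]; exact: (AB (x, y)).
Qed.

Lemma ucont_continuous (h : G -> R) : ucont h -> continuous h.
Proof.
move=> uh x; apply/cvgrPdist_le => e e0.
have := nbhs_subr x (uh e e0); apply: filterS => y /(_ x).
by rewrite [x + _]addrC subrK distrC.
Qed.

Lemma nbhs0_symm3 (V : set G) : nbhs 0 V -> exists W : set G,
  [/\ nbhs 0 W, forall x, W x -> W (- x) &
      forall x y z, W x -> W y -> W z -> V (x + y + z)].
Proof.
move=> /nbhs0_sub [A /nbhs0_sub [B B0 BA] AV].
have [C C0 CB] := nbhs0_sub B0.
exists (B `&` C `&` [set x | (B `&` C) (- x)]); split.
- apply: filterI; first exact: filterI.
  have := @opp_continuous G 0 (B `&` C); rewrite oppr0; apply; exact: filterI.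
- by move=> x [BCx BCNx]; split => //=; rewrite opprK.
move=> x y z [[Bx _] _] [_ [BNy _]] [_ [_ CNz]].
have := AV (x + y) (- z); rewrite opprK; apply.
  by have := BA x (- y); rewrite opprK; apply.
have B0z : B (0 - - z) by apply: CB => //; exact: nbhs_singleton C0.
have -> : - z = 0 - (0 - - z) by rewrite !sub0r opprK.
by apply: BA => //; exact: nbhs_singleton B0.
Qed.

Lemma split_seq_sum (T : Type) (a : T -> R) (l : seq T) (t : R) :
  0 <= t -> t < \sum_(p <- l) a p ->
  exists l1 p l2, [/\ l = l1 ++ p :: l2, \sum_(q <- l1) a q <= t &
    t < \sum_(q <- l1) a q + a p].
Proof.
elim: l t => [|p l IH] t t0; first by rewrite big_nil ltNge t0.
rewrite big_cons => tl; have [tp|pt] := ltP t (a p).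
  by exists [::], p, l; rewrite big_nil add0r.
have [||l1 [q [l2 [-> l1t tl1]]]] := IH (t - a p).
- by rewrite subr_ge0.
- by rewrite ltrBlDl.
exists (p :: l1), q, l2; split => //; rewrite big_cons; lra.
Qed.

Section Norm.
Variable V : nat -> set G.
Hypothesis V_T : V 0 = setT.
Hypothesis V_nbhs : forall n, nbhs 0 (V n).
Hypothesis V_symm : forall n x, V n x -> V n (- x).
Hypothesis V_add : forall n x y z, V n.+1 x -> V n.+1 y -> V n.+1 z -> V n (x + y + z).

(** Birkhoff-Kakutani construction: a chain writes a point as a sum of links, a link in [V n] costs
    [2^-1 ^+ n], and the norm of a point is the infimum of the costs of its chains. Thanks to
    [V 0 = setT] every point has a chain with one link. *)
Let cost (l : seq (nat * G)) : R := \sum_(p <- l) 2^-1 ^+ p.1.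
Let valid (l : seq (nat * G)) : Prop := forall p, p \in l -> V p.1 p.2.
Let total (l : seq (nat * G)) : G := \sum_(p <- l) p.2.

Let half_gt0 n : 0 < (2^-1 : R) ^+ n.
Proof. by rewrite exprn_gt0 // invr_gt0. Qed.

Let cost_ge0 l : 0 <= cost l.
Proof. by apply: sumr_ge0 => p _; exact: ltW. Qed.

(* Cutting the chain at half of its cost writes its sum as left part + one
   link + right part, all three of which lie in [V k.+1]. *)
Let chain_in n l k : (size l <= n)%N -> valid l -> cost l < 2^-1 ^+ k ->
  V k (total l).
Proof.
have V0 m : V m 0 by exact: nbhs_singleton.
elim: n l k => [|n IH] l k sl vl cl.
  by move: sl; rewrite leqn0 size_eq0 => /eqP ->; rewrite /total big_nil.
have [->|l0] := eqVneq l [::]; first by rewrite /total big_nil.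
have c0 : 0 < cost l.
  by case: l l0 {sl vl cl} => // p l _; rewrite /cost big_cons; apply: ltr_pwDl; [exact: half_gt0|exact: cost_ge0].
have [||l1 [p [l2 [El l1t tl1]]]] := @split_seq_sum _ (fun p => 2^-1 ^+ p.1) l (cost l / 2).
- by rewrite divr_ge0.
- by rewrite -/(cost l); lra.
have cE : cost l = cost l1 + (2^-1 ^+ p.1 + cost l2).
  by rewrite El /cost big_cat big_cons.
have hk : (2^-1 : R) ^+ k.+1 = 2^-1 ^+ k / 2 by rewrite exprS mulrC.
have v1 : valid l1 by move=> q q1; apply: vl; rewrite El mem_cat q1.
have v2 : valid l2 by move=> q q2; apply: vl; rewrite El mem_cat in_cons q2 !orbT.
have s12 : (size l1 <= n)%N /\ (size l2 <= n)%N.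
  move: sl; rewrite El size_cat /= addnS ltnS => sl.
  by split; apply: leq_trans sl; rewrite ?leq_addr ?leq_addl.
have -> : total l = total l1 + p.2 + total l2.
  by rewrite El /total big_cat big_cons /= addrA.
rewrite -/(cost l1) in l1t tl1.
have c1 := cost_ge0 l1; have c2 := cost_ge0 l2; have p0 := half_gt0 p.1.
apply: V_add.
- apply: IH => //; first by case: s12.
  by rewrite hk; lra.
- have Vp : V p.1 p.2 by apply: vl; rewrite El mem_cat in_cons eqxx orbT.
  have kp : (k < p.1)%N.
    rewrite ltnNge; apply/negP => pk.
    have : (2^-1 : R) ^+ k <= 2^-1 ^+ p.1.
      by apply: ler_wiXn2l => //; rewrite ?invr_ge0 ?invf_le1 // ler1n.
    by lra.
  have mono m : V (k.+1 + m) p.2 -> V k.+1 p.2.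
    elim: m => [|m IHm]; first by rewrite addn0.
    rewrite addnS => Vm; apply: IHm.
    by rewrite -[p.2]addr0 -[p.2]addr0; exact: V_add.
  by apply: (mono (p.1 - k.+1)%N); rewrite subnKC.
- apply: IH => //; first by case: s12.
  by rewrite hk; lra.
Qed.

Let costs (x : G) : set R := [set cost l | l in [set l | valid l /\ total l = x]].
Let N (x : G) : R := inf (costs x).

Let costs_inf x : has_inf (costs x).
Proof.
split; last by exists 0 => _ [l _ <-].
exists (cost [:: (0%N, x)]), [:: (0%N, x)] => //; split.
  by move=> p; rewrite mem_seq1 => /eqP ->; rewrite V_T.
by rewrite /total big_seq1.
Qed.

Let N_le l : valid l -> N (total l) <= cost l.
Proof. by move=> vl; apply: ge_inf; [case: (costs_inf (total l))|exists l]. Qed.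

Let N_lt x (e : R) : N x < e -> exists l, [/\ valid l, total l = x & cost l < e].
Proof.
rewrite -subr_gt0 => e0; have := inf_adherent e0 (costs_inf x).
case=> _ [l [vl lx] <-]; rewrite addrC subrK => le.
by exists l.
Qed.

Lemma exists_norm : exists N : G -> R, [/\ N 0 = 0,
  forall x y, N (x + y) <= N x + N y, forall x, N (- x) = N x,
  forall e : R, 0 < e -> \forall x \near (0 : G), N x < e &
  forall x, N x < 2^-1 -> V 1 x].
Proof.
have N_ge0 x : 0 <= N x.
  by apply: lb_le_inf; [case: (costs_inf x)|move=> _ [l _ <-]].
have N0 : N 0 = 0.
  apply/eqP; rewrite eq_le N_ge0 andbT.
  by have := @N_le [::]; rewrite /total /cost !big_nil; apply.
exists N; split => //.
- move=> x y; apply/ler_addgt0Pr => e e0.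
  have [|l1 [v1 <- c1]] := @N_lt x (N x + e / 2); first by lra.
  have [|l2 [v2 <- c2]] := @N_lt y (N y + e / 2); first by lra.
  have v12 : valid (l1 ++ l2).
    by move=> p; rewrite mem_cat => /orP[/v1|/v2].
  have := N_le v12; rewrite /total /cost !big_cat /= -/(total l1) -/(total l2).
  by rewrite -/(cost l1) -/(cost l2); lra.
- have half x : N (- x) <= N x.
    apply/ler_addgt0Pr => e e0.
    have [|l [v <- c]] := @N_lt x (N x + e); first by lra.
    have vN : valid [seq (p.1, - p.2) | p <- l].
      by move=> _ /mapP [p /v Vp ->] /=; exact: V_symm.
    have := N_le vN; rewrite /total /cost !big_map /= sumrN -/(total l) -/(cost l); lra.
  move=> x; apply/eqP; rewrite eq_le half /=.
  by have := half (- x); rewrite opprK.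
- move=> e e0; have [n ne] : exists n, (2^-1 : R) ^+ n < e.
    have : (2^-1 : R) ^+ n @[n --> \oo] --> 0.
      by apply: cvg_expr; rewrite ger0_norm ?invr_ge0 // invf_lt1 // ltr1n.
    by move=> /cvgr_lt /(_ e e0) [n _ /(_ n)] /= ?; exists n; auto.
  apply: filterS (V_nbhs n) => x Vx; apply: le_lt_trans ne.
  have := @N_le [:: (n, x)]; rewrite /total /cost !big_seq1 /=; apply.
  by move=> p; rewrite mem_seq1 => /eqP ->.
- move=> x; rewrite -[2^-1]expr1 => /N_lt [l [vl <- cl]].
  exact: (@chain_in (size l)).
Qed.

End Norm.

Lemma exists_bump (U : set G) : nbhs 0 U -> exists f : G -> R,
  [/\ forall x, 0 <= f x <= 1, f 0 = 1, ucont f & forall x, f x != 0 -> U x].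
Proof.
move=> U0; have /choice [r rP] : forall V : set G, exists W : set G, nbhs 0 V ->
   [/\ nbhs 0 W, forall x, W x -> W (- x) &
      forall x y z, W x -> W y -> W z -> V (x + y + z)].
  move=> V; have [V0|nV] := pselect (nbhs 0 V); last by exists V.
  by have [W ?] := nbhs0_symm3 V0; exists W.
have rn n : nbhs 0 (iter n r U) by elim: n => //= n /rP [].
pose V n := if n is m.+1 then iter m.+1 r U else setT.
have Vn n : nbhs 0 (V n) by case: n => [|n]; [exact: filterT|exact: (rn n.+1)].
have [||||N [N0 ND NN Nc NV]] := @exists_norm V => //.
- by case=> // n x; have [_ + _] := rP _ (rn n); apply.
- by case=> // n x y z; have [_ _ +] := rP _ (rn n.+1); apply.
have N_ge0 x : 0 <= N x.
  by have := ND x (- x); rewrite subrr N0 NN; lra.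
(* The factor 2 matches the threshold [2^-1] of [exists_norm]: where the bump is nonzero, [x] lies
   in [V 1 = r U], which is inside [U]. *)
exists (fun x => Num.max 0 (1 - 2 * N x)); split.
- by move=> x; rewrite le_max lexx /= ge_max ler01 /=; have := N_ge0 x; lra.
- by rewrite N0 mulr0 subr0 max_r.
- move=> e e0; have e2 : 0 < e / 2 by lra.
  apply: filterS (Nc _ e2) => v Nv x.
  have h1 := ND x v; have h2 := ND (x + v) (- v); rewrite addrK NN in h2.
  rewrite ler_norml; apply/andP; split;
  by case: (leP 0 (1 - 2 * N (x + v))) => ?; case: (leP 0 (1 - 2 * N x)) => ?; lra.
- move=> x; have [|Nx] := ltP (N x) 2^-1; last by rewrite max_l ?eqxx //; lra.
  move=> /NV /= r1 _; have [r0 _ rU] := rP U U0.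
  by rewrite -[x]addr0 -[x]addr0; apply: rU => //; exact: nbhs_singleton.
Qed.

(* If the closures had empty intersection, the sum of the functions [n * f_n],
   with [f_n] a bump inside [W n], would be locally finite, hence continuous,
   and unbounded. *)
Lemma pseudocompact_closure (W : nat -> set G) : pseudocompact R G ->
  (forall n, open (W n)) -> (forall n, W n !=set0) -> (forall n, W n.+1 `<=` W n) ->
  exists z, forall n, closure (W n) z.
Proof.
move=> pc oW nW dW; apply: contrapT => /forallNP nz.
have dW' m n : (m <= n)%N -> W n `<=` W m.
  move=> /subnKC <-; elim: (n - m)%N => [|k IH]; first by rewrite addn0.
  by rewrite addnS => y /dW /IH.
have /choice [n0 n0P] : forall z : G, exists n : nat, \forall x \near z, ~ W n x.
  move=> z; have /existsNP [n nc] : ~ forall n, closure (W n) z by exact: nz.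
  exists n; apply: contrapT => h; case: nc => A Az.
  apply: contrapT => e; apply: h; apply: filterS Az => x Ax Wx; apply: e.
  by exists x.
have /choice [f fP] : forall n : nat, exists f : G -> R,
   [/\ continuous f, forall x, 0 <= f x, forall x, f x != 0 -> W n x &
       exists2 x, W n x & f x = 1].
  move=> n; have [x Wx] := nW n.
  have /exists_bump [f [f01 f0 uf fW]] : \forall v \near (0 : G), W n (x + v).
    by apply: nbhs_addl; exact: open_nbhs_nbhs.
  exists (fun y => f (y - x)); split.
  - move=> y; apply: (@continuous_comp _ _ _ (fun y => y - x) f); last exact: ucont_continuous.
    apply: (@continuous_comp _ _ _ (fun y => (y, x)) (fun p : G * G => p.1 - p.2)).
      by apply: cvg_pair => /=; [exact: cvg_id|exact: cvg_cst].
    exact: sub_continuous.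
  - by move=> y; case/andP: (f01 (y - x)).
  - by move=> y /fW; rewrite addrC subrK.
  - by exists x => //; rewrite subrr.
have f00 n x : ~ W n x -> f n x = 0.
  by move=> nWx; apply/eqP; apply: contra_notT nWx; case: (fP n) => _ _ + _; apply.
pose g x := \sum_(i < n0 x) i%:R * f i x.
(* The cut-off in [g] is immaterial: every [m] with [x] outside [W m] gives the same value. Near [z]
   the single cut-off [n0 z] serves, so there [g] is a finite sum of continuous functions. *)
have gE m x : ~ W m x -> g x = \sum_(i < m) i%:R * f i x.
  have aux a b : (a <= b)%N -> ~ W a x ->
      \sum_(i < a) i%:R * f i x = \sum_(i < b) i%:R * f i x.
    move=> ab nWa; rewrite -!(big_mkord xpredT (fun i => i%:R * f i x)).
    rewrite (@big_cat_nat _ _ _ a 0 b) //= [X in _ = _ + X]big1_seq ?addr0 //.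
    move=> i /andP[_]; rewrite mem_index_iota => /andP[ai _].
    by rewrite f00 ?mulr0 // => /(dW' _ _ ai).
  move=> nWm; have nW0 : ~ W (n0 x) x by exact: nbhs_singleton (n0P x).
  by have [?|/ltnW ?] := leqP (n0 x) m; rewrite /g; [|symmetry]; exact: aux.
have cg : continuous g.
  move=> z; have zE : g z = \sum_(i < n0 z) i%:R * f i z by [].
  rewrite /continuous_at zE.
  have : \sum_(i < n0 z) i%:R * f i x @[x --> z] --> \sum_(i < n0 z) i%:R * f i z.
    by apply: cvg_sumr => i; apply: cvgMl_tmp; case: (fP i) => + _ _ _; apply.
  apply: cvg_trans; apply: near_eq_cvg.
  by apply: filterS (n0P z) => x /gE.
have [M gM] := pc g cg.
have [x Wx fx] : exists2 x, W (Num.bound `|M|) x & f (Num.bound `|M|) x = 1.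
  by case: (fP (Num.bound `|M|)).
have nx : (Num.bound `|M| < n0 x)%N.
  by rewrite ltnNge; apply/negP => /dW' /(_ x Wx); exact: nbhs_singleton (n0P x).
have := gM x; apply/negP; rewrite -ltNge.
apply: (@lt_le_trans _ _ (Num.bound `|M|)%:R).
  by rewrite (le_lt_trans (ler_norm M)) // archi_boundP.
rewrite (le_trans _ (ler_norm _)) // /g (bigD1 (Ordinal nx)) //= fx mulr1 lerDl.
by apply: sumr_ge0 => i _; rewrite mulr_ge0 //; case: (fP i).
Qed.

End TopologicalGroup.

Lemma separated_sequence (X : eqType) (V : X -> X -> Prop) :
  ~ (exists s : seq X, forall x, exists2 y, y \in s & V x y) ->
  exists u : nat -> X, forall i j, (i < j)%N -> ~ V (u j) (u i).
Proof.
move=> /forallNP nV.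
have /choice [r rP] : forall s : seq X, exists x, forall y, y \in s -> ~ V x y.
  move=> s; have /existsNP [x xP] := nV s; exists x => y ys Vxy; apply: xP.
  by exists y.
pose h := fix h n : seq X := if n is m.+1 then r (h m) :: h m else [::].
exists (fun n => r (h n)) => i j ij; apply: rP.
elim: j ij => // j IH; rewrite ltnS leq_eqVlt in_cons => /predU1P[->|/IH ->].
  by rewrite eqxx.
by rewrite orbT.
Qed.

(** For a separated sequence, let [W n] be the union of small neighbourhoods of the terms from [n]
    on. A common point of the closures is near two different terms, which are then near each
    other. *)
Lemma pseudocompact_precompact (R : realType) (G : topologicalZmodType) :
  pseudocompact R G -> precompact_group G.
Proof.
move=> pc V V0; apply: contrapT.
move=> /(@separated_sequence G (fun x y => V (x - y))) [u uP].
have [A A0 AV] := nbhs0_sub V0; have [B B0 BA] := nbhs0_sub A0.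
pose W n := \bigcup_(i in [set i | (n <= i)%N]) [set x | B^° (x - u i)].
have oW n : open (W n).
  apply: bigcup_open => i _.
  apply: (@open_comp _ _ (fun x => x - u i) (B^°)); last exact: open_interior.
  move=> y _; apply: (@continuous_comp _ _ _ (fun y => (y, u i)) (fun p : G * G => p.1 - p.2)).
    by apply: cvg_pair => /=; [exact: cvg_id|exact: cvg_cst].
  exact: sub_continuous.
have [||z zP] := @pseudocompact_closure R G W pc oW.
- by move=> n; exists (u n), n => //=; rewrite subrr.
- by move=> n x [i /= ni Bi]; exists i => //=; exact: ltnW.
have meet n : exists2 i, (n <= i)%N & A (z - u i).
  have := zP n _ (nbhs_subr z B0) => -[x [[i /= ni /interior_subset Bi]]] /= Bx.
  exists i => //; have := BA _ _ Bi Bx.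
  by rewrite opprB addrC addrA subrK.
have [i _ Ai] := meet 0%N; have [j ij Aj] := meet i.+1.
apply: (uP i j ij); have := AV _ _ Ai Aj.
by rewrite opprB addrC addrA subrK.
Qed.

(** * Almost periodicity on precompact groups *)

Lemma near_all_seq (T : Type) (I : eqType) (F : set_system T) (FF : Filter F)
    (s : seq I) (P : I -> T -> Prop) :
  (forall i, i \in s -> \forall t \near F, P i t) ->
  \forall t \near F, forall i, i \in s -> P i t.
Proof.
elim: s => [|i s IH] sP; first exact: nearW.
have Pi : \forall t \near F, P i t by apply: sP; rewrite mem_head.
have Ps : \forall t \near F, forall j, j \in s -> P j t.
  by apply: IH => j js; apply: sP; rewrite in_cons js orbT.
apply: filterS2 Pi Ps => t Pit Pst j.
by rewrite in_cons => /predU1P[->|/Pst].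
Qed.

Section RealCharacter.
Variables (R : realType) (G : zmodType) (c s : G -> R).
Hypothesis cs : rchar c s.

Lemma rchar0 : c 0 = 1 /\ s 0 = 0.
Proof.
have [cD sD c1] := cs; have := cD 0 0; have := sD 0 0; have := c1 0; rewrite addr0.
move: (c 0) (s 0) => a b h1 h2 h3.
have h4 : b * (2 * a - 1) = 0 by lra.
have /eqP := h4; rewrite mulf_eq0 => /orP[/eqP b0|/eqP a0]; last nra.
by subst b; split => //; nra.
Qed.

Lemma rcharN x : c (- x) = c x /\ s (- x) = - s x.
Proof.
have [cD sD c1] := cs; have [c0 s0] := rchar0.
have := cD x (- x); have := sD x (- x); rewrite subrr c0 s0 => h1 h2.
have h3 := c1 x.
have e1 : c x * (c x * c (- x) - s x * s (- x)) + s x * (s x * c (- x) + c x * s (- x)) =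
  (c x ^+ 2 + s x ^+ 2) * c (- x) by ring.
have e2 : c x * (s x * c (- x) + c x * s (- x)) - s x * (c x * c (- x) - s x * s (- x)) =
  (c x ^+ 2 + s x ^+ 2) * s (- x) by ring.
by move: e1 e2; rewrite -h1 -h2 h3; lra.
Qed.

Lemma rcharB x y : c (x - y) = c x * c y + s x * s y /\
  s (x - y) = s x * c y - c x * s y.
Proof.
by have [cD sD _] := cs; have [cN sN] := rcharN y; rewrite cD sD cN sN; split; ring.
Qed.

Lemma rchar_norm x : `|c x| <= 1 /\ `|s x| <= 1.
Proof.
have [_ _ /(_ x) c1] := cs; rewrite !ler_norml.
by split; apply/andP; split; nra.
Qed.

Lemma bounded_rchar : bounded_fn c /\ bounded_fn s.
Proof. by split; exists 1 => x; case: (rchar_norm x). Qed.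

End RealCharacter.

Section Equicontinuous.
Variables (R : realType) (G : topologicalZmodType).
Hypothesis preG : precompact_group G.

Definition equicont (T : Type) (v : T -> G -> R) : Prop :=
  forall e : R, 0 < e ->
    \forall u \near (0 : G), forall t x, `|v t (x + u) - v t x| <= e.

Variables (T : Type) (F : set_system T) (v : T -> G -> R) (w : G -> R).
Hypothesis FF : ProperFilter F.
Hypothesis ev : equicont v.
Hypothesis vw : forall x, v t x @[t --> F] --> w x.

Lemma ucont_lim : ucont w.
Proof.
move=> e e0; apply: filterS (ev e0) => u vu x.
have cB : `|v t (x + u) - v t x| @[t --> F] --> `|w (x + u) - w x|.
  by apply: cvg_norm; apply: cvgB.
by apply: (cvgr_to_le cB); near=> t.
Unshelve. all: by end_near. Qed.

(** The Arzela-Ascoli argument: convergence at the points of a finite net, transported to all points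
    by equicontinuity at the cost of two further thirds of [e]. *)
Lemma equicont_uniform (e : R) : 0 < e -> \forall t \near F, forall x, `|v t x - w x| <= e.
Proof.
move=> e0; have e3 : 0 < e / 3 by lra.
have [s sP] := preG (filterI (ev e3) (ucont_lim e3)).
have : \forall t \near F, forall y, y \in s -> `|v t y - w y| <= e / 3.
  apply: near_all_seq => y _.
  by have /cvgrPdist_le /(_ _ e3) := @vw y; apply: filterS => t; rewrite distrC.
apply: filterS => t ts x; have [y ys [/(_ t y) + /(_ y)]] := sP x.
rewrite [y + _]addrC subrK; have := ts y ys.
rewrite !ler_norml => /andP[? ?] /andP[? ?] /andP[? ?].
by apply/andP; split; lra.
Qed.

End Equicontinuous.

(** Finitely many translates of the set where [k] is at least [k 0 / 2] cover [G]. So a finite sum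
    of translates of [k], all with the same mean, is at least [k 0 / 2]. *)
Lemma nonneg_mean_gt0 (R : realType) (G : topologicalZmodType) (U : set_system (seq G)) (k : G -> R) :
  precompact_group G -> UltraFilter U -> (\forall F \near U, F <> [::]) ->
  almost_invariant R (fun a x : G => x + a) U ->
  ucont k -> bounded_fn k -> (forall x, 0 <= k x) -> 0 < k 0 -> 0 < mean U k.
Proof.
move=> preG UU U0 Uinv uk bk k0 k00.
have k2 : 0 < k 0 / 2 by rewrite divr_gt0.
have [s sP] := preG _ (uk _ k2).
have bky y : bounded_fn (fun x => k (x - y)) by exact: bounded_fn_comp.
have : k 0 / 2 <= mean U (fun x => \sum_(y <- s) k (x - y)).
  rewrite -[X in X <= _](mean_cst UU U0); apply: mean_le.
  - exact: bounded_fn_cst.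
  - exact: bounded_fn_sum.
  move=> x; have [y ys /(_ 0)] := sP x; rewrite add0r ler_norml => /andP[h _].
  rewrite (big_rem y) //=.
  have : 0 <= \sum_(y <- rem y s) k (x - y) by exact: sumr_ge0.
  by lra.
rewrite mean_sum //.
have inv y : mean U (fun x => k (x - y)) = mean U k.
  exact: (mean_invariant UU Uinv (- y) bk).
under eq_bigr do rewrite inv.
rewrite big_const_seq count_predT iter_addr_0 => h.
rewrite lt_def mean_ge0 // andbT; apply/negP => /eqP m0.
by move: h; rewrite m0 mul0rn; lra.
Qed.

Section Completeness.
Variables (R : realType) (G : topologicalZmodType) (U : set_system (seq G)).
Hypothesis preG : precompact_group G.
Hypothesis UU : UltraFilter U.
Hypothesis U0 : \forall F \near U, F <> [::].
Hypothesis Uinv : almost_invariant R (fun a x : G => x + a) U.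
Local Notation mean := (mean U).

Let minv a (k : G -> R) : bounded_fn k -> mean (fun x => k (x + a)) = mean k.
Proof. exact: (mean_invariant UU Uinv a). Qed.

Let mean_gt0 (k : G -> R) : ucont k -> bounded_fn k -> (forall x, 0 <= k x) ->
  0 < k 0 -> 0 < mean k.
Proof. exact: nonneg_mean_gt0. Qed.

Lemma mean_avg (F : seq G) (k : G -> G -> R) : (forall x, bounded_fn (k x)) ->
  mean (fun z => avg F (fun x => k x z)) = avg F (fun x => mean (k x)).
Proof.
move=> bk; rewrite /avg; under eq_fun do rewrite mulrC.
by rewrite meanZ ?mean_sum // 1?mulrC //; exact: bounded_fn_sum.
Qed.

Lemma mean_cvg_mul (T : Type) (F : set_system T) (FF : ProperFilter F)
    (v : T -> G -> R) (w c : G -> R) (M : R) :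
  equicont v -> (forall x, v t x @[t --> F] --> w x) ->
  (forall t x, `|v t x| <= M) -> (forall x, `|c x| <= 1) ->
  mean (fun x => v t x * c x) @[t --> F] --> mean (fun x => w x * c x).
Proof.
move=> ev vw vM c1; have bc : bounded_fn c by exists 1.
have bv t : bounded_fn (v t) by exists M.
have bw : bounded_fn w.
  exists M => x; apply: (cvgr_to_le (cvg_norm (vw x))); exact: nearW.
apply/cvgrPdist_le => e e0.
apply: filterS (equicont_uniform preG FF ev vw e0) => t vte.
rewrite distrC; apply: mean_dist => //; try exact: bounded_fnM.
move=> x; rewrite -mulrBl normrM -[e]mulr1; exact: ler_pM.
Qed.

Definition cont_rchar (c s : G -> R) : Prop :=
  [/\ rchar c s, continuous c & continuous s].

Definition fourier0 (h : G -> R) : Prop := forall c s, cont_rchar c s ->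
  mean (fun x => h x * c x) = 0 /\ mean (fun x => h x * s x) = 0.

Lemma fourier0_translate (h : G -> R) y : bounded_fn h -> fourier0 h ->
  fourier0 (fun x => h (x + y)).
Proof.
move=> bh h0 c s ccs; have [hc hs] := h0 c s ccs; have [cs _ _] := ccs.
have [bc bs] := bounded_rchar cs.
have bhc := bounded_fnM bh bc; have bhs := bounded_fnM bh bs.
split.
  rewrite -(minv (- y)); last by apply: bounded_fnM => //; exact: bounded_fn_comp.
  under eq_fun do rewrite subrK (proj1 (rcharB cs _ _)).
  rewrite (_ : (fun _ => _) = (fun x => c y * (h x * c x) + s y * (h x * s x))); last first.
    by apply/funext => x; ring.
  rewrite meanD ?meanZ ?hc ?hs ?mulr0 ?addr0 //; apply: bounded_fnM => //; exact: bounded_fn_cst.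
rewrite -(minv (- y)); last by apply: bounded_fnM => //; exact: bounded_fn_comp.
under eq_fun do rewrite subrK (proj2 (rcharB cs _ _)).
rewrite (_ : (fun _ => _) = (fun x => c y * (h x * s x) - s y * (h x * c x))); last first.
  by apply/funext => x; ring.
rewrite meanB ?meanZ ?hc ?hs ?mulr0 ?subr0 //; apply: bounded_fnM => //; exact: bounded_fn_cst.
Qed.

Definition autocorr (h : G -> R) (x : G) : R := mean (fun y => h y * h (y + x)).

Section Autocorrelation.
Variable h : G -> R.
Hypothesis uh : ucont h.
Hypothesis bh : bounded_fn h.

Let bhh a b : bounded_fn (fun y => h (y + a) * h (y + b)).
Proof. by apply: bounded_fnM; exact: bounded_fn_comp. Qed.

Lemma autocorrB a b : autocorr h (a - b) = mean (fun y => h (y + a) * h (y + b)).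
Proof.
rewrite /autocorr -(minv b); last by apply: bounded_fnM => //; exact: bounded_fn_comp.
by congr mean; apply/funext => y; rewrite mulrC addrA addrAC addrK.
Qed.

Lemma autocorr_even x : autocorr h (- x) = autocorr h x.
Proof.
rewrite -[in LHS]sub0r -[in RHS](subr0 x) !autocorrB.
by congr mean; apply/funext => y; rewrite mulrC.
Qed.

Lemma autocorr_posdef : posdef (autocorr h).
Proof.
move=> s; under eq_bigr do under eq_bigr do rewrite autocorrB -meanZ //.
have b1 p q : bounded_fn (fun y => p.1 * q.1 * (h (y + p.2) * h (y + q.2))).
  by apply: bounded_fnM => //; exact: bounded_fn_cst.
under eq_bigr do rewrite -mean_sum //.
rewrite -(mean_sum UU U0); last by move=> p; exact: bounded_fn_sum.
apply: mean_ge0 => [|y]; first by apply: bounded_fn_sum => p; exact: bounded_fn_sum.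
rewrite (_ : \sum_(p <- s) _ = (\sum_(p <- s) p.1 * h (y + p.2)) ^+ 2) ?sqr_ge0 //.
rewrite expr2 mulr_suml; apply: eq_bigr => p _; rewrite mulr_sumr.
by apply: eq_bigr => q _; ring.
Qed.

Lemma avg_autocorr_equicont :
  equicont (fun F x => avg F (fun y => h y * h (y + x)) : R).
Proof.
have [M hM] := bh; move=> e e0; pose N := `|M| + 1.
have N0 : 0 < N by rewrite ltr_wpDl.
have eN : 0 < e / N by rewrite divr_gt0.
apply: filterS (uh eN) => u hu F x; rewrite -avgB; apply: avg_norm; first exact: ltW.
move=> y; rewrite -mulrBr normrM addrA -[e](divfK (lt0r_neq0 N0)) mulrC.
apply: ler_pM => //; rewrite (le_trans (hM y)) // /N.
by have := ler_norm M; lra.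
Qed.

Lemma cvg_avg_autocorr x :
  avg F (fun y => h y * h (y + x)) @[F --> U] --> autocorr h x.
Proof. by apply: cvg_avg; apply: bounded_fnM => //; exact: bounded_fn_comp. Qed.

Lemma autocorr_ucont : ucont (autocorr h).
Proof. exact: ucont_lim avg_autocorr_equicont cvg_avg_autocorr. Qed.

(** The autocorrelation is a uniform limit of finite combinations of translates of [h], each of them
    orthogonal to the continuous characters. *)
Lemma autocorr_fourier0 : fourier0 h -> fourier0 (autocorr h).
Proof.
move=> h0 c s ccs; have [cs _ _] := ccs.
have [bc bs] := bounded_rchar cs; have [M hM] := bh.
have b0 (F : seq G) x : `|avg F (fun y => h y * h (y + x))| <= `|M| ^+ 2.
  apply: avg_norm => [|y]; first exact: sqr_ge0.
  by rewrite normrM expr2; apply: ler_pM => //; rewrite (le_trans (hM _)) // ler_norm.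
have z d : bounded_fn d -> (forall y, mean (fun x => h (x + y) * d x) = 0) ->
    forall F, mean (fun x => avg F (fun y => h y * h (y + x)) * d x) = 0.
  move=> bd hd F; rewrite (_ : (fun _ => _) =
    (fun x => avg F (fun y => h y * (h (x + y) * d x)))); last first.
    apply/funext => x; rewrite mulrC -avgZ; congr avg; apply/funext => y.
    by rewrite (addrC y); ring.
  have bhd y : bounded_fn (fun x => h (x + y) * d x).
    by apply: bounded_fnM => //; exact: bounded_fn_comp.
  rewrite mean_avg; last by move=> y; apply: bounded_fnM => //; exact: bounded_fn_cst.
  rewrite (_ : (fun _ => _) = (fun=> 0)); last first.
    by apply/funext => y; rewrite meanZ // hd mulr0.
  by rewrite /avg big1_eq mul0r.
have tr y := fourier0_translate y bh h0 ccs.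
have go d : (forall x, `|d x| <= 1) -> (forall y, mean (fun x => h (x + y) * d x) = 0) ->
    mean (fun x => autocorr h x * d x) = 0.
  move=> d1 hd; have bd : bounded_fn d by exists 1.
  have := mean_cvg_mul (@ultra_proper _ U UU) avg_autocorr_equicont cvg_avg_autocorr b0 d1.
  under eq_fun do rewrite z //.
  by move=> /cvg_lim <- //; rewrite lim_cst.
by split; apply: go => [x|y]; (try by case: (rchar_norm cs x)); case: (tr y).
Qed.

End Autocorrelation.

(* The Fourier coefficients [avg F (psi * c)] of a positive definite [psi] over
   the Folner sets [F] are maximised by some character, which is not assumed to
   be continuous; its limit along [U] is an eigenvector of translation whose
   eigenfunction is a limit of combinations of translates of [psi]: it is
   therefore continuous and correlated with [psi]. *)
Section PositiveDefiniteSpectrum.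
Variable psi : G -> R.
Hypothesis upsi : ucont psi.
Hypothesis ppsi : posdef psi.
Hypothesis epsi : forall x, psi (- x) = psi x.
Hypothesis psi1 : psi 0 = 1.

Let npsi x : `|psi x| <= 1.
Proof. by rewrite -psi1; exact: posdef_norm. Qed.

Let bpsi : bounded_fn psi.
Proof. by exists 1. Qed.

Let twist (d : seq G -> G -> R) (F : seq G) (z : G) : R :=
  avg F (fun x => psi (x + z) * d F x).

Let twist_norm d F z : (forall F x, `|d F x| <= 1) -> `|twist d F z| <= 1.
Proof.
move=> d1; apply: avg_norm => // x.
by rewrite normrM -[1]mulr1; exact: ler_pM.
Qed.

Let twist_equicont d : (forall F x, `|d F x| <= 1) -> equicont (twist d).
Proof.
move=> d1 e e0; apply: filterS (upsi e0) => u pu F z; rewrite -avgB.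
apply: avg_norm; first exact: ltW.
by move=> x; rewrite -mulrBl normrM -[e]mulr1 addrA; exact: ler_pM.
Qed.

Let twist_cvg d z : (forall F x, `|d F x| <= 1) -> cvg (twist d F z @[F --> U]).
Proof. by move=> d1; apply: (@ultra_cvg_bound _ _ U UU _ 1) => F; exact: twist_norm. Qed.

Let twist_shift d z : (forall F x, `|d F x| <= 1) ->
  avg F (fun x => psi x * d F (x - z)) @[F --> U] --> lim (twist d F z @[F --> U]).
Proof.
move=> d1; have tz := @twist_cvg d z d1.
have -> : lim (twist d F z @[F --> U]) = lim (twist d F z @[F --> U]) - 0 by rewrite subr0.
rewrite (_ : (fun F => _) = (fun F => twist d F z -
   (twist d F z - avg F (fun x => psi x * d F (x - z))))); last first.
  by apply/funext => F; ring.
apply: cvgB => //; apply/cvgrPdist_le => e e0.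
have := avg_almost_invariant UU Uinv z 1 e0; apply: filterS => F.
move=> /(_ (fun x => psi x * d F (x - z))).
rewrite sub0r normrN /twist; under eq_fun do rewrite addrK.
by apply => x; rewrite normrM -[1]mulr1; exact: ler_pM.
Qed.

Lemma posdef_not_fourier0 : ~ fourier0 psi.
Proof.
move=> psi0; pose dl := mean (fun x => psi x ^+ 2).
have upsi2 : ucont (fun x => psi x ^+ 2).
  move=> e e0; have e2 : 0 < e / 2 by lra.
  apply: filterS (upsi e2) => u pu x.
  have -> : psi (x + u) ^+ 2 - psi x ^+ 2 = (psi (x + u) - psi x) * (psi (x + u) + psi x) by ring.
  rewrite normrM -[e](@divfK _ 2) //; apply: ler_pM => //.
  by rewrite (le_trans (ler_normD _ _)) // -[2]/(1 + 1) lerD.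
have bpsi2 : bounded_fn (fun x => psi x ^+ 2).
  by under eq_fun do rewrite expr2; exact: bounded_fnM.
have dl0 : 0 < dl.
  by apply: mean_gt0 => // [x|]; [exact: sqr_ge0|rewrite psi1 expr1n].
have dl2 : 0 < dl / 2 by lra.
(* The functional is the average over [F] of the product with [psi]. Its value at [psi] tends to
   [dl > 0], so a loss of [dl / 2] still leaves the limit [C 0] positive. *)
have /choice [cs csP] : forall F : seq G, exists cs : (G -> R) * (G -> R), rchar cs.1 cs.2 /\
    avg F (fun x => psi x ^+ 2) - dl / 2 <= avg F (fun x => psi x * cs.1 x).
  move=> F; have := posdef_rchar [seq (psi x / (size F)%:R, x) | x <- F] dl2 ppsi epsi psi1.
  case=> c [s [ccs]]; rewrite !big_map /= => le; exists (c, s); split => //=.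
  by rewrite /avg !mulr_suml; congr (_ <= _): le; [congr (_ - _)|];
    apply: eq_bigr => x _; ring.
pose c F := (cs F).1; pose s F := (cs F).2.
have csF F : rchar (c F) (s F) by case: (csP F).
have c1 F x : `|c F x| <= 1 by case: (rchar_norm (csF F) x).
have s1 F x : `|s F x| <= 1 by case: (rchar_norm (csF F) x).
have cc x : cvg (c F x @[F --> U]) by apply: (@ultra_cvg_bound _ _ U UU _ 1).
have sc x : cvg (s F x @[F --> U]) by apply: (@ultra_cvg_bound _ _ U UU _ 1).
pose c' x := lim (c F x @[F --> U]); pose s' x := lim (s F x @[F --> U]).
have eqlim (f g : seq G -> R) (a b : R) : f =1 g -> f F @[F --> U] --> a ->
    g F @[F --> U] --> b -> a = b.
  move=> /funext -> ga gb; exact: (cvg_unique (@Rhausdorff R) ga gb).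
have cs' : rchar c' s'.
  split => [x y|x y|x].
  - apply: (eqlim _ (fun F => c F x * c F y - s F x * s F y) _ _ _ (cc _)).
      by move=> F; case: (csF F).
    by apply: cvgB; apply: cvgM; [exact: cc|exact: cc|exact: sc|exact: sc].
  - apply: (eqlim _ (fun F => s F x * c F y + c F x * s F y) _ _ _ (sc _)).
      by move=> F; case: (csF F).
    by apply: cvgD; apply: cvgM; [exact: sc|exact: cc|exact: cc|exact: sc].
  - apply: (eqlim (fun F => c F x * c F x + s F x * s F x) (fun=> 1)).
    + by move=> F; have [_ _ /(_ x)] := csF F; rewrite !expr2.
    + by rewrite !expr2; apply: cvgD; apply: cvgM; [exact: cc|exact: cc|exact: sc|exact: sc].
    + exact: cvg_cst.
pose C z := lim (twist c F z @[F --> U]); pose S z := lim (twist s F z @[F --> U]).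
have tc z : twist c F z @[F --> U] --> C z by exact: twist_cvg.
have ts z : twist s F z @[F --> U] --> S z by exact: twist_cvg.
(* In complex terms [C + i S] is the conjugate of [c' + i s'] times the constant [C 0 + i S 0]. This
   constant is nonzero, so [c'] and [s'] inherit continuity from [C] and [S]. *)
have CE z : C z = c' z * C 0 + s' z * S 0.
  apply: (eqlim _ (fun F => c F z * twist c F 0 + s F z * twist s F 0) _ _ _ (@twist_shift c z c1)).
    move=> F; rewrite /twist -!avgZ -avgD; congr avg; apply/funext => x.
    by rewrite (proj1 (rcharB (csF F) _ _)) addr0; ring.
  by apply: cvgD; apply: cvgM; [exact: cc|exact: tc|exact: sc|exact: ts].
have SE z : S z = c' z * S 0 - s' z * C 0.
  apply: (eqlim _ (fun F => c F z * twist s F 0 - s F z * twist c F 0) _ _ _ (@twist_shift s z s1)).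
    move=> F; rewrite /twist -!avgZ -avgB; congr avg; apply/funext => x.
    by rewrite (proj2 (rcharB (csF F) _ _)) addr0; ring.
  by apply: cvgB; apply: cvgM; [exact: cc|exact: ts|exact: sc|exact: tc].
have C0 : 0 < C 0.
  apply: (lt_le_trans dl2).
  have cl : twist c F 0 - (avg F (fun x => psi x ^+ 2) - dl / 2) @[F --> U] -->
      C 0 - (dl - dl / 2).
    by apply: cvgB; [exact: tc|apply: cvgB; [exact: cvg_avg|exact: cvg_cst]].
  have : 0 <= C 0 - (dl - dl / 2).
    apply: (cvgr_to_ge cl); apply: nearW => F; rewrite subr_ge0 /twist.
    by under [X in _ <= avg F X]eq_fun do rewrite addr0; case: (csP F).
  by lra.
have cC : continuous C.
  by apply: ucont_continuous; exact: ucont_lim (twist_equicont c1) tc.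
have cS : continuous S.
  by apply: ucont_continuous; exact: ucont_lim (twist_equicont s1) ts.
pose D := C 0 ^+ 2 + S 0 ^+ 2.
have D0 : D != 0 by apply: lt0r_neq0; rewrite ltr_pwDl ?sqr_ge0 // exprn_gt0.
have c'E : c' = (fun z => (C z * C 0 + S z * S 0) / D).
  by apply/funext => z; apply: (mulIf D0); rewrite divfK // (CE z) (SE z) /D; ring.
have s'E : s' = (fun z => (C z * S 0 - S z * C 0) / D).
  by apply/funext => z; apply: (mulIf D0); rewrite divfK // (CE z) (SE z) /D; ring.
have ccs' : cont_rchar c' s'.
  split => //.
    rewrite c'E => z; apply: cvgMr_tmp; apply: cvgD; apply: cvgMr_tmp; [exact: cC|exact: cS].
  rewrite s'E => z; apply: cvgMr_tmp; apply: cvgB; apply: cvgMr_tmp; [exact: cC|exact: cS].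
have [c'1 s'1] : (forall x, `|c' x| <= 1) /\ (forall x, `|s' x| <= 1).
  by split => x; case: (rchar_norm cs' x).
have tr y := fourier0_translate y bpsi psi0 ccs'.
have zero d (D' : G -> R) e : (forall F x, `|d F x| <= 1) -> (forall x, `|e x| <= 1) ->
    (forall z, twist d F z @[F --> U] --> D' z) ->
    (forall y, mean (fun x => psi (x + y) * e x) = 0) ->
    mean (fun z => D' z * e z) = 0.
  move=> d1 e1 tD pe; have be : bounded_fn e by exists 1.
  have := mean_cvg_mul (@ultra_proper _ U UU) (twist_equicont d1) tD (fun F x => twist_norm F x d1) e1.
  suff z0 F : mean (fun z => twist d F z * e z) = 0.
    by under eq_fun do rewrite z0; move=> /cvg_lim <- //; rewrite lim_cst.
  rewrite /twist (_ : (fun _ => _) =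
    (fun z => avg F (fun x => d F x * (psi (z + x) * e z)))); last first.
    apply/funext => z; rewrite mulrC -avgZ; congr avg; apply/funext => x.
    by rewrite (addrC x); ring.
  have bp y : bounded_fn (fun x => psi (x + y) * e x).
    by apply: bounded_fnM => //; exact: bounded_fn_comp.
  rewrite mean_avg; last by move=> y; apply: bounded_fnM => //; exact: bounded_fn_cst.
  rewrite (_ : (fun _ => _) = (fun=> 0)); last first.
    by apply/funext => y; rewrite meanZ // pe mulr0.
  by rewrite /avg big1_eq mul0r.
have bC : bounded_fn C.
  by exists 1 => z; apply: (cvgr_to_le (cvg_norm (tc z))); apply: nearW => F; exact: twist_norm.
have bS : bounded_fn S.
  by exists 1 => z; apply: (cvgr_to_le (cvg_norm (ts z))); apply: nearW => F; exact: twist_norm.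
have [bc bs] := bounded_rchar cs'.
(* This function is the constant [C 0 > 0], yet [C] and [S] are limits of averages of translates of
   [psi], all orthogonal to [c'] and [s']. *)
have : mean (fun z => C z * c' z - S z * s' z) = 0.
  rewrite meanB; [|exact: bounded_fnM|exact: bounded_fnM].
  rewrite (zero c C c') ?(zero s S s') ?subr0 // => y; by case: (tr y).
rewrite (_ : (fun _ => _) = (fun=> C 0)); last first.
  apply/funext => z; rewrite (CE z) (SE z); have [_ _ /(_ z) z1] := cs'.
  by rewrite -[RHS]mulr1 -z1; ring.
by rewrite mean_cst // => C00; move: C0; rewrite C00 ltxx.
Qed.

End PositiveDefiniteSpectrum.

(** The autocorrelation divided by its value at 0 would be a positive definite function with
    vanishing coefficients. That value is the mean of [h ^+ 2], positive as soon as [h 0 != 0]. *)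
Lemma fourier0_eq0 (h : G -> R) : ucont h -> bounded_fn h -> fourier0 h -> h 0 = 0.
Proof.
move=> uh bh h0; apply/eqP; apply: contrapT => /negP hn0.
pose a := autocorr h 0.
have a0 : 0 < a.
  rewrite /a /autocorr; under eq_fun do rewrite addr0 -expr2.
  have [M hM] := bh; pose N := `|M| + 1.
  have N0 : 0 < N by rewrite ltr_wpDl.
  have hN x : `|h x| <= N by rewrite (le_trans (hM x)) // /N; have := ler_norm M; lra.
  apply: mean_gt0.
  - move=> e e0; have eN : 0 < e / (2 * N) by rewrite divr_gt0 // mulr_gt0.
    apply: filterS (uh _ eN) => u hu x.
    have -> : h (x + u) ^+ 2 - h x ^+ 2 = (h (x + u) - h x) * (h (x + u) + h x) by ring.
    rewrite normrM -[e](@divfK _ (2 * N)) ?gt_eqF ?mulr_gt0 //; apply: ler_pM => //.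
    by rewrite (le_trans (ler_normD _ _)) // mulr_natl mulr2n lerD.
  - by under eq_fun do rewrite expr2; exact: bounded_fnM.
  - by move=> x; exact: sqr_ge0.
  - by rewrite lt_def sqr_ge0 sqrf_eq0 hn0.
have ai : 0 <= a^-1 by rewrite invr_ge0 ltW.
have ba : bounded_fn (autocorr h).
  exists a => x; apply: posdef_norm; first exact: autocorr_posdef.
  by move=> y; exact: autocorr_even.
apply: (@posdef_not_fourier0 (fun x => a^-1 * autocorr h x)).
- move=> e e0; have ea : 0 < e * a by rewrite mulr_gt0.
  apply: filterS (autocorr_ucont uh bh ea) => u hu x.
  by rewrite -mulrBr normrM ger0_norm // ler_pdivrMl // mulrC.
- move=> s.
  under eq_bigr do [under eq_bigr do rewrite mulrCA; rewrite -mulr_sumr].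
  by rewrite -mulr_sumr mulr_ge0 //; exact: autocorr_posdef.
- by move=> x; rewrite autocorr_even.
- by rewrite mulVf // gt_eqF.
- move=> c s ccs; have [hc hs] := autocorr_fourier0 uh bh h0 ccs.
  have [cs _ _] := ccs; have [bc bs] := bounded_rchar cs.
  split; under eq_fun do rewrite -mulrA; rewrite meanZ ?hc ?hs ?mulr0 //; exact: bounded_fnM.
Qed.

End Completeness.

(* If no Bohr neighbourhood were contained in [V], some ultrafilter outside [V]
   would converge to 0 along all characters; the limiting translate of a bump
   function inside [V] then has the same Fourier coefficients as the bump, but a
   different value at 0. *)
Theorem precompact_bohr (R : realType) (G : topologicalZmodType) (V : set G) :
  precompact_group G -> nbhs 0 V ->
  exists (s : seq ((G -> R) * (G -> R))) (e : R), [/\ 0 < e,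
    forall p, p \in s -> cont_rchar p.1 p.2 &
    forall x, (forall p, p \in s -> 1 - p.1 x < e) -> V x].
Proof.
move=> preG V0; apply: contrapT => nB.
have [U [UU U0 Uinv]] := @folner_ultrafilter R G 0 G (fun a x => x + a)
  (fun i j x => addrAC x j i).
have [f [f01 f0 uf fV]] := @exists_bump R G V V0.
pose good (s : seq ((G -> R) * (G -> R))) := forall p, p \in s -> cont_rchar p.1 p.2.
pose B (se : seq ((G -> R) * (G -> R)) * R) : set G :=
  [set x | ~ V x /\ forall p, p \in se.1 -> 1 - p.1 x < se.2].
have PB : ProperFilter (filter_from [set se | good se.1 /\ 0 < se.2] B).
  apply: filter_from_proper.
    apply: filter_from_filter; first by exists ([::], 1); split.
    move=> [s1 e1] [s2 e2] [/= g1 p1] [/= g2 p2].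
    exists (s1 ++ s2, Num.min e1 e2).
      split => /=; last by rewrite lt_min p1.
      by move=> p; rewrite mem_cat => /orP[/g1|/g2].
    move=> x [nV xP]; split; split => //= p ps.
      by have := xP p; rewrite /= mem_cat ps lt_min => /(_ isT) /andP[].
    by have := xP p; rewrite /= mem_cat ps orbT lt_min => /(_ isT) /andP[].
  move=> [s e] [/= gs e0]; apply: contrapT => nx; apply: nB; exists s, e; split => //.
  by move=> x xs; apply: contrapT => nV; apply: nx; exists x.
have [W [UW BW]] := ultraFilterLemma PB.
have f1 x : `|f x| <= 1 by case/andP: (f01 x) => ? ?; rewrite ger0_norm.
have bf : bounded_fn f by exists 1.
pose v x z := f (z + x).
have vc z : cvg (v x z @[x --> W]) by apply: (@ultra_cvg_bound _ _ W UW _ 1) => x; exact: f1.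
pose f' z := lim (v x z @[x --> W]).
have ev : equicont v.
  by move=> e e0; apply: filterS (uf e e0) => u fu x z; rewrite /v addrAC.
have uf' : ucont f' by exact: ucont_lim ev vc.
have bf' : bounded_fn f'.
  by exists 1 => z; apply: (cvgr_to_le (cvg_norm (vc z))); apply: nearW => x; exact: f1.
have f'0 : f' 0 = 0.
  apply: cvg_lim => //; apply: cvg_near_cst; apply: BW; exists ([::], 1) => //.
  move=> x [nVx _]; rewrite /v add0r; apply/eqP; apply: contra_notT nVx; exact: fV.
have : f' 0 - f 0 = 0.
  apply: (@fourier0_eq0 _ _ U preG UU U0 Uinv (fun z => f' z - f z)).
  - move=> e e0; have e2 : 0 < e / 2 by lra.
    apply: filterS2 (uf' _ e2) (uf _ e2) => u h1 h2 x.
    have -> : f' (x + u) - f (x + u) - (f' x - f x) =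
      (f' (x + u) - f' x) - (f (x + u) - f x) by ring.
    by rewrite (le_trans (ler_normB _ _)) // [e](splitr e) lerD.
  - exact: bounded_fnB.
  move=> c s ccs; have [cs _ _] := ccs; have [bc bs] := bounded_rchar cs.
  have [c1 s1] : (forall x, `|c x| <= 1) /\ (forall x, `|s x| <= 1).
    by split => x; case: (rchar_norm cs x).
  have bfc := bounded_fnM bf bc; have bfs := bounded_fnM bf bs.
  have cW : c x @[x --> W] --> (1 : R).
    apply/cvgrPdist_le => e e0; apply: BW; exists ([:: (c, s)], e).
      by split => //= p; rewrite mem_seq1 => /eqP ->.
    move=> x [_ /(_ (c, s))]; rewrite /= mem_seq1 eqxx => /(_ isT) xe.
    have cx : 0 <= 1 - c x by rewrite subr_ge0 (le_trans (ler_norm _)).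
    by rewrite ger0_norm // ltW.
  have sW : s x @[x --> W] --> (0 : R).
    have s2 : s x ^+ 2 @[x --> W] --> (0 : R).
      rewrite (_ : (fun x => s x ^+ 2) = (fun x => 1 - c x * c x)); last first.
        by apply/funext => x; have [_ _ /(_ x) h] := cs; rewrite -h; ring.
      have -> : (0 : R) = 1 - 1 * 1 by ring.
      by apply: cvgB; [exact: cvg_cst|exact: cvgM].
    apply/cvgrPdist_le => e e0; have e2 : 0 < e ^+ 2 by rewrite exprn_gt0.
    move/cvgrPdist_le : s2 => /(_ _ e2); apply: filterS => x.
    rewrite !sub0r !normrN normrX => h.
    by rewrite -(@ler_pXn2r _ 2) // ?nnegrE ?(ltW e0).
  (* Translating [f] by [x] rotates its coefficient by the value of the character at [x], which
     tends to 1 along [W]; so [f'] and [f] have equal coefficients. *)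
  have lc d : (forall x, `|d x| <= 1) ->
      mean U (fun z => f (z + x) * d z) @[x --> W] --> mean U (fun z => f' z * d z).
    by move=> d1; apply: (mean_cvg_mul preG UU U0 (@ultra_proper _ W UW) ev vc (fun x z => f1 _) d1).
  have shift d (bd : bounded_fn d) x :
      mean U (fun z => f (z + x) * d z) = mean U (fun z => f z * d (z - x)).
    rewrite -(mean_invariant UU Uinv (- x)); last first.
      by apply: bounded_fnM => //; exact: bounded_fn_comp.
    by congr mean; apply/funext => z; rewrite subrK.
  split; under eq_fun do rewrite mulrBl;
    rewrite meanB //; try exact: bounded_fnM; apply/eqP; rewrite subr_eq0; apply/eqP.
    have -> : mean U (fun z => f z * c z) = 1 * mean U (fun z => f z * c z) +
      0 * mean U (fun z => f z * s z) by ring.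
    apply: (cvg_unique (@Rhausdorff R) (lc _ c1)).
    rewrite (_ : (fun x => mean U (fun z => f (z + x) * c z)) = (fun x => c x * mean U (fun z => f z * c z) +
       s x * mean U (fun z => f z * s z))); last first.
      apply/funext => x; rewrite shift // -!meanZ // -meanD; first last.
      - by apply: bounded_fnM => //; exact: bounded_fn_cst.
      - by apply: bounded_fnM => //; exact: bounded_fn_cst.
      congr mean; apply/funext => z; rewrite (proj1 (rcharB cs _ _)); ring.
    by apply: cvgD; apply: cvgMr_tmp.
  have -> : mean U (fun z => f z * s z) = 1 * mean U (fun z => f z * s z) -
    0 * mean U (fun z => f z * c z) by ring.
  apply: (cvg_unique (@Rhausdorff R) (lc _ s1)).
  rewrite (_ : (fun x => mean U (fun z => f (z + x) * s z)) = (fun x => c x * mean U (fun z => f z * s z) -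
     s x * mean U (fun z => f z * c z))); last first.
    apply/funext => x; rewrite shift // -!meanZ // -meanB; first last.
    - by apply: bounded_fnM => //; exact: bounded_fn_cst.
    - by apply: bounded_fnM => //; exact: bounded_fn_cst.
    congr mean; apply/funext => z; rewrite (proj2 (rcharB cs _ _)); ring.
  by apply: cvgB; apply: cvgMr_tmp.
by rewrite f'0 f0; lra.
Qed.

(** * Compact sets of characters *)

Lemma cvg_set_type (X : topologicalType) (A : set X) (T : Type) (F : set_system T)
    (FF : Filter F) (f : T -> A) (a : A) :
  (set_val (f t) : X) @[t --> F] --> (set_val a : X) -> f t @[t --> F] --> a.
Proof.
move=> fa U [_ /= [[W oW <-] /= Wa WU]].
have nW : nbhs (set_val a : X) W by apply: open_nbhs_nbhs; split.
by apply: (@filterS _ F FF (fun t => W (set_val (f t)))) => [t|]; [exact: WU|exact: fa].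
Qed.

Lemma continuous_set_val (X : topologicalType) (A : set X) :
  continuous (set_val : A -> X).
Proof. exact: initial_continuous. Qed.

Section Torus.
Variable R : realType.

Definition tre (t : Torus R) : R := (set_val t : R * R).1.
Definition tim (t : Torus R) : R := (set_val t : R * R).2.

Lemma tre_tim t : tre t ^+ 2 + tim t ^+ 2 = 1.
Proof. by rewrite /tre /tim; case: t => -[a b] /= h; move: (set_mem h). Qed.

Lemma torus_inj t t' : tre t = tre t' -> tim t = tim t' -> t = t'.
Proof.
move=> h1 h2; apply: val_inj; move: h1 h2; rewrite /tre /tim !set_valE /=.
by case: t => -[a b] /= ?; case: t' => -[a' b'] /= ? -> ->.
Qed.

Lemma mk_torus (a b : R) : a ^+ 2 + b ^+ 2 = 1 -> exists t, tre t = a /\ tim t = b.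
Proof.
move=> ab; have h : (a, b) \in circleT R by apply: mem_set.
by exists (exist _ (a, b) h).
Qed.

Lemma continuous_tre : continuous tre.
Proof.
move=> t; apply: (@continuous_comp _ _ _ (set_val : Torus R -> R * R) fst).
  exact: continuous_set_val.
exact: cvg_fst.
Qed.

Lemma continuous_tim : continuous tim.
Proof.
move=> t; apply: (@continuous_comp _ _ _ (set_val : Torus R -> R * R) snd).
  exact: continuous_set_val.
exact: cvg_snd.
Qed.

Lemma cvg_torus (T : Type) (F : set_system T) (FF : Filter F) (f : T -> Torus R) t :
  tre (f x) @[x --> F] --> tre t -> tim (f x) @[x --> F] --> tim t ->
  f x @[x --> F] --> t.
Proof.
move=> h1 h2; apply: cvg_set_type.
have -> : (fun x => set_val (f x) : R * R) = (fun x => (tre (f x), tim (f x))).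
  by apply/funext => x; rewrite /tre /tim; case: (set_val (f x)).
rewrite (_ : set_val t = (tre t, tim t)); last by rewrite /tre /tim; case: (set_val t).
exact: (@cvg_pair _ _ _ F (nbhs (tre t)) (nbhs (tim t)) FF _ _ _ _ h1 h2).
Qed.

End Torus.

Section CompactOpen.
Variables (R : realType) (X : topologicalType) (A : set {compact-open, X -> Torus R}).

Definition ev (a : A) (x : X) : Torus R := (set_val a : X -> Torus R) x.

Lemma continuous_ev (x : X) : continuous (fun a : A => ev a x).
Proof.
move=> a; apply: (@continuous_comp _ _ _ (set_val : A -> {compact-open, X -> Torus R})
  (fun g : {compact-open, X -> Torus R} => (g : X -> Torus R) x)).
  exact: continuous_set_val.
move=> B; rewrite nbhsE => -[Q [oQ Qx] QB].
have := compact_open_open (@compact_set1 X x) oQ.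
rewrite openE => /(_ (set_val a)) /= h.
apply: filterS (h _); last by move=> _ [y -> <-].
by move=> g gQ; apply: QB; apply: gQ; exists x.
Qed.

(** On a finite compact set the subbasic condition concerns finitely many points. This serves for
    [X = G] and again for [X = Dual R G]. *)
Lemma cvg_compact_open (T : Type) (F : set_system T) (FF : Filter F) (f : T -> A) (a : A) :
  (forall K : set X, compact K -> finite_set K) ->
  (forall x, ev (f t) x @[t --> F] --> ev a x) -> f t @[t --> F] --> a.
Proof.
move=> finK fa; apply: cvg_set_type; apply/compact_open_cvgP => K O cK oO aKO.
have /finite_seqP [s Ks] := finK K cK.
have : \forall t \near F, forall x, x \in s -> O (ev (f t) x).
  apply: near_all_seq => x xs; apply: (fa x); apply: open_nbhs_nbhs; split => //.
  by apply: aKO; exists x => //; rewrite Ks.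
by apply: filterS => t tO _ [x Kx <-]; apply: tO; move: Kx; rewrite Ks.
Qed.

End CompactOpen.

Section RealCharacters.
Variables (R : realType) (G : zmodType).
Implicit Types c s : G -> R.

Lemma rchar_div c s c' s' : rchar c s -> rchar c' s' ->
  rchar (fun x => c x * c' x + s x * s' x) (fun x => s x * c' x - c x * s' x).
Proof.
move=> [cD sD c1] [cD' sD' c1']; split => [x y|x y|x].
- by rewrite cD sD cD' sD'; ring.
- by rewrite cD sD cD' sD'; ring.
- by rewrite -[1]mulr1 -{1}(c1 x) -(c1' x); ring.
Qed.

(** A squared triangle inequality between 1 and the values at [x] and [x + y]; the square in [h1] is
    the term that the parallelogram law discards. *)
Lemma rchar_distD c s x y : rchar c s ->
  1 - c (x + y) <= 2 * (1 - c x) + 2 * (1 - c y).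
Proof.
move=> [cD _ c1]; rewrite cD; have := c1 x; have := c1 y.
move: (c x) (s x) (c y) (s y) => a b a' b' h' h.
have h1 : 0 <= (1 - 2 * a + (a * a' - b * b')) ^+ 2 + (2 * b - (a * b' + b * a')) ^+ 2.
  by rewrite addr_ge0 ?sqr_ge0.
have h2 : (a * a' - b * b') ^+ 2 + (a * b' + b * a') ^+ 2 = 1.
  by rewrite -[RHS]mulr1 -{1}h -h'; ring.
have h3 : a * (a * a' - b * b') + b * (a * b' + b * a') = a'.
  by rewrite -[RHS]mul1r -h; ring.
by nra.
Qed.

(** The circle has no small subgroups: [1 - c (x + x)] equals [2 * (1 - c x) * (1 + c x)], at least
    [3 * (1 - c x)] when [c x] is at least 1/2. Repeated doubling would exceed the bound unless
    [c x = 1]. *)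
Lemma rchar_trivial c s : rchar c s -> (forall x, 1 - c x <= 2^-1) ->
  forall x, c x = 1 /\ s x = 0.
Proof.
move=> cs h.
have [cD _ c1] := cs.
have le1 x : c x <= 1 by case: (rchar_norm cs x) => /(le_trans (ler_norm _)).
have h3 n x : 3 ^+ n * (1 - c x) <= 2^-1.
  elim: n x => [|n IH] x; first by rewrite expr0 mul1r.
  apply: le_trans (IH (x + x)); rewrite exprSr -mulrA ler_pM2l ?exprn_gt0 //.
  by rewrite cD; have := c1 x; have := h x; have := le1 x; nra.
have cx1 x : c x = 1.
  apply/eqP; rewrite eq_le le1 /=; apply: contrapT => /negP; rewrite -ltNge => cx.
  have d0 : 0 < 1 - c x by rewrite subr_gt0.
  pose n := Num.bound (1 - c x)^-1.
  have : (1 - c x)^-1 < n%:R by rewrite archi_boundP // invr_ge0 ltW.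
  have nn : (n%:R : R) <= 3 ^+ n by rewrite -natrX ler_nat ltnW // ltn_expl.
  move=> /lt_le_trans /(_ nn); rewrite -div1r ltr_pdivrMr // => lt1.
  by have := h3 n x; lra.
by move=> x; split => //; have := c1 x; rewrite cx1; nra.
Qed.

Lemma rchar_eq1 c s x : rchar c s -> 1 <= c x -> c x = 1 /\ s x = 0.
Proof.
move=> cs c1; have [_ _ /(_ x) h] := cs; have [+ _] := rchar_norm cs x.
rewrite ler_norml => /andP[_ c1']; have cx : c x = 1 by lra.
by split => //; move: h; rewrite cx; nra.
Qed.

End RealCharacters.

Section Dual.
Variables (R : realType) (G : topologicalZmodType).
Implicit Types chi : Dual R G.

Definition re chi (x : G) : R := tre (ev chi x).
Definition im chi (x : G) : R := tim (ev chi x).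

Lemma dual_rchar chi : cont_rchar (re chi) (im chi).
Proof.
have [cchi chiD] := set_valP chi; split.
- split => [x y|x y|x]; rewrite /re /im; last exact: tre_tim.
    by rewrite /tre /tim /ev chiD.
  by rewrite /tre /tim /ev chiD /= addrC.
- by move=> x; apply: (@continuous_comp _ _ _ (ev chi) (@tre R)); [exact: cchi|exact: continuous_tre].
- by move=> x; apply: (@continuous_comp _ _ _ (ev chi) (@tim R)); [exact: cchi|exact: continuous_tim].
Qed.

Lemma dual_ext chi chi' : re chi =1 re chi' -> im chi =1 im chi' -> chi = chi'.
Proof.
move=> h1 h2; apply: val_inj; apply/funext => x; exact: (torus_inj (h1 x) (h2 x)).
Qed.

Lemma rchar_dual (c s : G -> R) : cont_rchar c s ->
  exists chi, re chi = c /\ im chi = s.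
Proof.
move=> [[cD sD c1] cc cs].
have /choice [f fP] : forall x, exists t : Torus R, tre t = c x /\ tim t = s x.
  by move=> x; exact: mk_torus.
have fd : (f : {compact-open, G -> Torus R}) \in dual_set R G.
  apply: mem_set; split.
    move=> x; apply: cvg_torus.
      by rewrite (proj1 (fP x)); under eq_fun do rewrite (proj1 (fP _)); exact: cc.
    by rewrite (proj2 (fP x)); under eq_fun do rewrite (proj2 (fP _)); exact: cs.
  move=> x y; have [h1 h2] := fP (x + y); have [h3 h4] := fP x; have [h5 h6] := fP y.
  rewrite /cmul -/(tre (f x)) -/(tre (f y)) -/(tim (f x)) -/(tim (f y)) h3 h4 h5 h6.
  rewrite (_ : set_val (f (x + y)) = (tre (f (x + y)), tim (f (x + y)))).
    by rewrite h1 h2 cD sD [s x * _ + _]addrC.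
  by rewrite /tre /tim; case: (set_val _).
exists (SigSub fd : Dual R G); split; apply/funext => x; by case: (fP x).
Qed.

Lemma continuous_re x : continuous (fun chi => re chi x).
Proof.
move=> chi; apply: (@continuous_comp _ _ _ (fun chi => ev chi x) (@tre R)).
  exact: continuous_ev.
exact: continuous_tre.
Qed.

Lemma continuous_im x : continuous (fun chi => im chi x).
Proof.
move=> chi; apply: (@continuous_comp _ _ _ (fun chi => ev chi x) (@tim R)).
  exact: continuous_ev.
exact: continuous_tim.
Qed.

End Dual.

Lemma closure_le (R : realType) (X : topologicalType) (A : set X) (g : X -> R) (a : R) z :
  {for z, continuous g} -> (forall x, A x -> g x <= a) -> closure A z -> g z <= a.
Proof.
move=> cg Ag Az; rewrite leNgt; apply/negP => az.
have [x [Ax]] := Az _ (cvgr_gt _ cg _ az).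
by rewrite /= ltNge Ag.
Qed.

Section CompactDual.
Variables (R : realType) (G : topologicalZmodType).
Hypothesis pcG : pseudocompact R G.
Variable K : set (Dual R G).
Hypothesis cK : compact K.

Section Accumulation.
Variables (W : set_system (Dual R G)) (chi0 : Dual R G).
Hypothesis UW : UltraFilter W.
Hypothesis WK : W K.
Hypothesis Wne : W [set chi | chi <> chi0].
Hypothesis Wchi0 : W --> chi0.

(** [th + i ths] is the quotient of [chi] by [chi0], so [1 - th chi x] measures how far apart the
    two are at [x]. *)
Let th (chi : Dual R G) x := re chi x * re chi0 x + im chi x * im chi0 x.
Let ths (chi : Dual R G) x := im chi x * re chi0 x - re chi x * im chi0 x.

Let th_rchar chi : cont_rchar (th chi) (ths chi).
Proof.
have [cs cc cs'] := dual_rchar chi; have [cs0 cc0 cs0'] := dual_rchar chi0.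
split; first exact: rchar_div.
  by move=> x; apply: cvgD; apply: cvgM; [exact: cc|exact: cc0|exact: cs'|exact: cs0'].
by move=> x; apply: cvgB; apply: cvgM; [exact: cs'|exact: cc0|exact: cc|exact: cs0'].
Qed.

Let th_cvg (T : Type) (F : set_system T) (FF : Filter F) (f : T -> Dual R G) xi x :
  f @ F --> xi -> th (f t) x @[t --> F] --> th xi x.
Proof.
move=> fxi; apply: cvgD; apply: cvgMr_tmp.
  by apply: (continuous_cvg _ (@continuous_re R G x xi) fxi).
by apply: (continuous_cvg _ (@continuous_im R G x xi) fxi).
Qed.

Let th0 x : th chi0 x = 1.
Proof.
have [[_ _ /(_ x) h] _ _] := dual_rchar chi0.
by rewrite /th -!expr2.
Qed.

(** Choose [chi] close to [chi0] at [v0] and on a net [Y]. If it were also close on [V], write [x]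
    as [(y - v0) + (v0 + (x - y))] with the second summand in [V]: [rchar_distD], used twice, bounds
    [1 - th chi x] by [8/20 + 2/20], the [2^-1] of [rchar_trivial]. Then [chi = chi0], against
    [Wne]. *)
Let far_point (V : set G) (L : seq G) (e : R) : 0 < e -> open V -> V !=set0 ->
  exists chi, [/\ K chi, forall x, x \in L -> 1 - th chi x < e &
    (V `&` [set x | 20^-1 < 1 - th chi x]) !=set0].
Proof.
move=> e0 oV [v0 Vv0]; have preG := pseudocompact_precompact pcG.
have Vn : \forall u \near (0 : G), V (v0 + u).
  by apply: nbhs_addl; exact: open_nbhs_nbhs.
have [Y YP] := preG _ Vn.
have near1 x (d : R) : 0 < d -> \forall chi \near W, 1 - th chi x < d.
  move=> d0; have h : th chi x @[chi --> W] --> (1 : R).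
    by rewrite -(th0 x); exact: (th_cvg _ Wchi0).
  have /(cvgr_gt _ h) : 1 - d < (1 : R) by lra.
  by apply: filterS => chi; lra.
have : \forall chi \near W, forall x, x \in L -> 1 - th chi x < e.
  by apply: near_all_seq => x _; exact: near1.
have : \forall chi \near W, forall x, x \in v0 :: Y -> 1 - th chi x < 20^-1.
  by apply: near_all_seq => x _; exact: near1.
move=> h1 h2.
have [chi [[Kchi nchi] [hY hL]]] := filter_ex (filterI (filterI WK Wne) (filterI h1 h2)).
exists chi; split => //; apply: contrapT => nV.
have Vs x : V x -> 1 - th chi x <= 20^-1.
  by move=> Vx; rewrite leNgt; apply/negP => lx; apply: nV; exists x.
have [cs _ _] := th_rchar chi.
have triv : forall x, th chi x = 1 /\ ths chi x = 0.
  apply: (rchar_trivial cs) => x.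
  have [y yY Vy] := YP x.
  have t1 := rchar_distD (y - v0) (v0 + (x - y)) cs.
  have t2 := rchar_distD y (- v0) cs.
  rewrite (proj1 (rcharN cs v0)) in t2.
  have e1 : y - v0 + (v0 + (x - y)) = x by rewrite addrA subrK addrC subrK.
  rewrite e1 in t1.
  have hy : 1 - th chi y < 20^-1 by apply: hY; rewrite in_cons yY orbT.
  have hv : 1 - th chi v0 < 20^-1 by apply: hY; rewrite mem_head.
  by have := Vs _ Vy; lra.
apply: nchi; have [[_ _ n1] _ _] := dual_rchar chi.
have [[_ _ n0] _ _] := dual_rchar chi0.
have E x : re chi x = re chi0 x /\ im chi x = im chi0 x.
  have := triv x; rewrite /th /ths; have := n1 x; have := n0 x.
  move: (re chi x) (im chi x) (re chi0 x) (im chi0 x) => a b a' b' h0 h [e1 e2].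
  have i1 : a = (a * a' + b * b') * a' - (b * a' - a * b') * b'.
    by rewrite -[LHS]mulr1 -h0; ring.
  have i2 : b = (a * a' + b * b') * b' + (b * a' - a * b') * a'.
    by rewrite -[LHS]mulr1 -h0; ring.
  by rewrite e1 e2 in i1 i2; split; lra.
by apply: dual_ext => x; case: (E x).
Qed.

(* Diagonal construction: [l] collects the chosen characters, [V] the points
   where they stay away from [chi0], and [L] nets on which they tend to [chi0]. *)
Lemma no_accumulation : False.
Proof.
have preG := pseudocompact_precompact pcG.
pose eps (n : nat) : R := n.+1%:R^-1.
have eps0 n : 0 < eps n by rewrite invr_gt0 ltr0n.
pose state := (seq (Dual R G) * set G * seq G)%type.
pose ok (st : state) (o : Dual R G * seq G) := [/\ K o.1,
  forall x, x \in st.2 -> 1 - th o.1 x < eps (size st.1.1),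
  (st.1.2 `&` [set x | 20^-1 < 1 - th o.1 x]) !=set0,
  {subset st.2 <= o.2} &
  forall y, exists2 d, d \in o.2 & forall chi, chi \in o.1 :: st.1.1 ->
    1 - re chi (y - d) < eps (size st.1.1)].
have /choice [nx nxP] : forall st : state, exists o, open st.1.2 -> st.1.2 !=set0 -> ok st o.
  move=> [[l V] L]; have [[oV V0]|nV] := pselect (open V /\ V !=set0); last first.
    by exists (chi0, [::]) => /= ? ?; case: nV.
  have [chi [Kchi hL hV]] := far_point L (eps0 (size l)) oV V0.
  have : \forall u \near (0 : G), forall chi', chi' \in chi :: l ->
      1 - re chi' u < eps (size l).
    apply: near_all_seq => chi' _; have [cs cc _] := dual_rchar chi'.
    have [r0 _] := rchar0 cs.
    have /(cvgr_gt _ (cc 0)) : 1 - eps (size l) < re chi' 0 by rewrite r0; have := eps0 (size l); lra.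
    by apply: filterS => u /=; lra.
  move=> /preG [Y YP]; exists (chi, L ++ Y) => _ _; split => //=.
    by move=> x xL; rewrite mem_cat xL.
  by move=> y; have [d dY h] := YP y; exists d => //; rewrite mem_cat dY orbT.
pose next (st : state) : state := let o := nx st in
  (o.1 :: st.1.1, st.1.2 `&` [set x | 20^-1 < 1 - th o.1 x], o.2).
(* Having [chi0] in the initial list makes the nets control it as well; this is also why
   [size (l n)] is [n.+1]. *)
pose st n := iter n next (([:: chi0], setT, [::]) : state).
pose V n := (st n).1.2; pose L n := (st n).2; pose l n := (st n).1.1.
pose u n := (nx (st n)).1.
have oth chi : open [set x | 20^-1 < 1 - th chi x].
  have [_ cc _] := th_rchar chi.
  rewrite openE => x /= hx; rewrite /interior.
  have /(cvgr_lt _ (cc x)) : th chi x < 1 - 20^-1 by lra.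
  by apply: filterS => y /=; lra.
have VP n : open (V n) /\ V n !=set0.
  elim: n => [|n [oV V0]]; first by split; [exact: openT|exists 0].
  split; first by apply: openI.
  by case: (nxP (st n) oV V0).
have okn n : ok (st n) (nx (st n)) by case: (VP n) => oV V0; exact: nxP.
have szl n : size (l n) = n.+1 by elim: n => //= n IH; rewrite /l /= -/(l n) IH.
have [z zP] := pseudocompact_closure pcG (fun n => proj1 (VP n)) (fun n => proj2 (VP n))
  (fun n => @subIsetl _ _ _).
have zfar n : th (u n) z <= 1 - 20^-1.
  have [_ cc _] := th_rchar (u n).
  apply: (closure_le (cc z) _ (zP n.+1)) => x [_ /=]; rewrite -/(u n); lra.
have [N [UN ooN]] := ultraFilterLemma eventually_filter.
have [|xi Kxi uxi] := ultra_cvg_compact UN (f := u) cK.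
  by apply: filterE => n; case: (okn n).
have cu x : th (u n) x @[n --> N] --> th xi x by exact: th_cvg.
have xiz : th xi z <= 1 - 20^-1.
  by apply: (cvgr_to_le (cu z)); apply: filterE => n; exact: zfar.
have Lmono m n : (m <= n)%N -> {subset L m <= L n}.
  move=> /subnKC <-; elim: (n - m)%N => [|k IH] x; first by rewrite addn0.
  by rewrite addnS => /IH; case: (okn (m + k)%N) => _ _ _ + _; apply.
have inv_small (e : R) : 0 < e -> \forall n \near \oo, eps n.+1 <= e.
  move=> e0; have := near_infty_natSinv_lt (PosNum e0); apply: filterS => n /= h.
  by apply: le_trans (ltW h); rewrite lef_pV2 ?posrE ?ltr0n // ler_nat.
have xiL m d : d \in L m -> 1 <= th xi d.
  move=> dL; apply/ler_addgt0Pr => e e0; rewrite -lerBlDr.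
  apply: (cvgr_to_ge (cu d)); apply: ooN.
  have mn : \forall n \near \oo, (m <= n)%N by exists m.
  apply: filterS2 (inv_small e e0) mn => n ne mn.
  have [_ /(_ d (Lmono _ _ mn _ dL)) + _ _ _] := okn n.
  by rewrite -/(l n) szl -/(u n); lra.
(* [O j] contains a net point that the listed characters barely distinguish from [z]; there [xi]
   agrees with [chi0] by [xiL]. At a common point [y] of the closures [chi0] and all [u n], hence
   [xi], take the same values as at [z]. But [1 - th xi] is at most [40^-1] at [y] and at least
   [20^-1] at [z]. *)
pose O j := [set x | (forall chi, chi \in l j.+1 -> 1 - re chi (x - z) < eps j.+1) /\
   1 - th xi x < 40^-1].
have crez (chi : Dual R G) (y : G) : {for y, continuous (fun x => re chi (x - z))}.
  have [_ cc _] := dual_rchar chi.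
  apply: (@continuous_comp _ _ _ (fun x => x - z) (re chi)); last exact: cc.
  apply: (@continuous_comp _ _ _ (fun y => (y, z)) (fun p : G * G => p.1 - p.2)).
    by apply: cvg_pair => /=; [exact: cvg_id|exact: cvg_cst].
  exact: sub_continuous.
have [y yP] : exists y, forall j, closure (O j) y.
  apply: (pseudocompact_closure pcG) => j.
  - rewrite openE => x [h1 h2]; rewrite /interior; apply: filterI.
      apply: near_all_seq => chi /h1 hchi.
      have /(cvgr_gt _ (crez chi x)) : 1 - eps j.+1 < re chi (x - z) by lra.
      by apply: filterS => y /=; lra.
    have [_ cc _] := th_rchar xi.
    have /(cvgr_gt _ (cc x)) : 1 - 40^-1 < th xi x by lra.
    by apply: filterS => y /=; lra.
  - have [_ _ _ _ /(_ z) [d dL dP]] := okn j; exists d; split.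
      move=> chi /dP; rewrite -/(l j) szl; have [cs _ _] := dual_rchar chi.
      by rewrite -(opprB d z) (proj1 (rcharN cs _)).
    have := xiL j.+1 d dL; have : (0 : R) < 40^-1 by rewrite invr_gt0. lra.
  - move=> x [h1 h2]; split => // chi chil.
    apply: (@lt_le_trans _ _ (eps j.+2)); last by rewrite /eps lef_pV2 ?posrE ?ltr0n // ler_nat.
    by apply: h1; rewrite in_cons chil orbT.
have lmono m n : (m <= n)%N -> {subset l m <= l n}.
  move=> /subnKC <-; elim: (n - m)%N => [|k IH] x; first by rewrite addn0.
  by rewrite addnS => /IH xl; rewrite in_cons xl orbT.
have lyz m chi : chi \in l m -> 1 <= re chi (y - z).
  move=> chil; apply/ler_addgt0Pr => e e0.
  have mn : \forall n \near \oo, (m <= n)%N by exists m.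
  have [n [ne mn']] := filter_ex (filterI (inv_small e e0) mn).
  have cN : {for y, continuous (fun x => 1 - re chi (x - z))}.
    by apply: cvgB; [exact: cvg_cst|exact: crez].
  have : 1 - re chi (y - z) <= eps n.+1.
    apply: (closure_le cN _ (yP n)) => x [/(_ chi) h _]; apply: ltW; apply: h.
    exact: (lmono m n.+1 (leqW mn')).
  by move: ne => /=; lra.
have r0 : re chi0 (y - z) = 1 /\ im chi0 (y - z) = 0.
  by have [cs _ _] := dual_rchar chi0; apply: (rchar_eq1 cs); apply: (lyz 0%N); rewrite mem_head.
have rxi : re xi (y - z) = 1 /\ im xi (y - z) = 0.
  have [cs _ _] := dual_rchar xi; apply: (rchar_eq1 cs).
  have cxi : re (u n) (y - z) @[n --> N] --> re xi (y - z).
    by apply: (continuous_cvg _ (@continuous_re R G (y - z) xi) uxi).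
  apply: (cvgr_to_ge cxi); apply: filterE => n; apply: (lyz n.+1).
  exact: mem_head.
have [cs cc _] := th_rchar xi.
have [cD _ _] := cs.
have : th xi y = th xi z.
  have -> : y = z + (y - z) by rewrite addrC subrK.
  have [t1 t2] : th xi (y - z) = 1 /\ ths xi (y - z) = 0.
    by rewrite /th /ths; case: r0 => -> ->; case: rxi => -> ->; split; ring.
  by rewrite cD t1 t2; ring.
have cN : {for y, continuous (fun x => 1 - th xi x)}.
  by apply: cvgB; [exact: cvg_cst|exact: cc].
have : 1 - th xi y <= 40^-1.
  by apply: (closure_le cN _ (yP 0%N)) => x [_ /ltW].
by lra.
Qed.

End Accumulation.

Lemma compact_dual_finite : finite_set K.
Proof.
apply: contrapT => infK.
pose B (s : seq (Dual R G)) : set (Dual R G) := [set chi | K chi /\ chi \notin s].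
have PB : ProperFilter (filter_from setT B).
  apply: filter_from_proper.
    apply: filter_from_filter; first by exists [::].
    move=> s t _ _; exists (s ++ t) => // chi [Kchi]; rewrite mem_cat negb_or => /andP[? ?].
    by split; split.
  move=> s _; apply: contrapT => nchi; apply: infK.
  apply: (@sub_finite_set _ _ [set` s]); last exact: finite_seq.
  by move=> chi Kchi /=; apply: contrapT => /negP ns; apply: nchi; exists chi.
have [W [UW BW]] := ultraFilterLemma PB.
have WK : W K by apply: BW; exists [::] => // chi [].
have [chi0 _ Wchi0] := ultra_cvg_compact UW (f := id) cK WK.
apply: (no_accumulation UW WK (chi0 := chi0)) => //.
apply: BW; exists [:: chi0] => // chi [_]; rewrite mem_seq1 => /eqP; exact.
Qed.

End CompactDual.

(** * Characters of the dual group *)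

Lemma unit_distD (R : realType) (a b a' b' a'' b'' : R) :
  a ^+ 2 + b ^+ 2 = 1 -> a' ^+ 2 + b' ^+ 2 = 1 -> a'' ^+ 2 + b'' ^+ 2 = 1 ->
  1 - (a * a'' + b * b'') <=
    2 * (1 - (a * a' + b * b')) + 2 * (1 - (a' * a'' + b' * b'')).
Proof.
move=> h h' h''.
have : 0 <= (a - 2 * a' + a'') ^+ 2 + (b - 2 * b' + b'') ^+ 2.
  by rewrite addr_ge0 ?sqr_ge0.
by nra.
Qed.

Section BidualEval.
Variables (R : realType) (G : topologicalZmodType).
Hypothesis finK : forall K : set G, compact K -> finite_set K.
Local Notation D := (Dual R G).

Lemma dual_div_ex (ab : D * D) : exists c : D,
  (forall x, re c x = re ab.1 x * re ab.2 x + im ab.1 x * im ab.2 x) /\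
  (forall x, im c x = im ab.1 x * re ab.2 x - re ab.1 x * im ab.2 x).
Proof.
have [cs cc cs'] := dual_rchar ab.1; have [cs0 cc0 cs0'] := dual_rchar ab.2.
have [] := @rchar_dual R G (fun x => re ab.1 x * re ab.2 x + im ab.1 x * im ab.2 x)
  (fun x => im ab.1 x * re ab.2 x - re ab.1 x * im ab.2 x).
  split; first exact: rchar_div.
    by move=> x; apply: cvgD; apply: cvgM; [exact: cc|exact: cc0|exact: cs'|exact: cs0'].
  by move=> x; apply: cvgB; apply: cvgM; [exact: cs'|exact: cc0|exact: cc|exact: cs0'].
by move=> c [rc ic]; exists c; rewrite rc ic.
Qed.

Definition dual_div (a b : D) : D := sval (cid (dual_div_ex (a, b))).

Lemma re_div a b x : re (dual_div a b) x = re a x * re b x + im a x * im b x.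
Proof. by rewrite /dual_div; case: cid => c [/= + _]; apply. Qed.

Lemma im_div a b x : im (dual_div a b) x = im a x * re b x - re a x * im b x.
Proof. by rewrite /dual_div; case: cid => c [/= _ +]; apply. Qed.

Lemma dual_divAC a b c : dual_div (dual_div a b) c = dual_div (dual_div a c) b.
Proof. by apply: dual_ext => x; rewrite ?(re_div, im_div); ring. Qed.

Lemma dual_one_ex : exists c : D, (forall x, re c x = 1) /\ (forall x, im c x = 0).
Proof.
have [] := @rchar_dual R G (fun=> 1) (fun=> 0).
  split; last 2 first; [exact: cst_continuous|exact: cst_continuous|].
  by split => [x y|x y|x]; ring.
by move=> c [rc ic]; exists c; rewrite rc ic.
Qed.

Lemma near_one_cvg (one : D) : (forall x, re one x = 1) -> (forall x, im one x = 0) ->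
  forall P : set D, nbhs one P -> exists (s : seq G) (e : R), 0 < e /\
    forall chi, (forall x, x \in s -> 1 - re chi x < e) -> P chi.
Proof.
move=> r1 i1 P nP.
pose B (se : seq G * R) : set D := [set chi | forall x, x \in se.1 -> 1 - re chi x < se.2].
have FB : Filter (filter_from [set se | 0 < se.2] B).
  apply: filter_from_filter; first by exists ([::], 1) => /=.
  move=> [s e] [t d] /= e0 d0; exists (s ++ t, Num.min e d); first by rewrite /= lt_min e0.
  move=> chi h; split => x /= xs.
    by have := h x; rewrite /= mem_cat xs lt_min => /(_ isT) /andP[].
  by have := h x; rewrite /= mem_cat xs orbT lt_min => /(_ isT) /andP[].
suff : id chi @[chi --> filter_from [set se | 0 < se.2] B] --> one.
  by move=> /(_ _ nP) [[s e] e0 BP]; exists s, e.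
apply: cvg_compact_open => // x.
have dist0 (chi : D) (e : R) : 1 - re chi x < e -> `|1 - re chi x| <= e /\ im chi x ^+ 2 <= 2 * e.
  have [cs _ _] := dual_rchar chi; have [+ _] := rchar_norm cs x.
  have [_ _ /(_ x) h] := cs; rewrite !ler_norml => /andP[? ?] ?.
  by split; [apply/andP; split; lra|nra].
apply: cvg_torus.
  rewrite -/(re one x) r1; apply/cvgrPdist_le => e e0; exists ([:: x], e) => // chi /= h.
  by apply: (proj1 (dist0 _ _ _)); apply: h; rewrite mem_head.
rewrite -/(im one x) i1; apply/cvgrPdist_le => e e0.
exists ([:: x], e ^+ 2 / 2); first by rewrite /= divr_gt0 // exprn_gt0.
move=> chi /= h; rewrite sub0r normrN -(@ler_pXn2r _ 2) // ?nnegrE ?(ltW e0) //.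
rewrite real_normK ?num_real //.
have /dist0 [_] : 1 - re chi x < e ^+ 2 / 2 by apply: h; rewrite mem_head.
by rewrite -/(im chi x); lra.
Qed.

(** The values of a separated sequence have a pointwise ultralimit [(r, i)] on the unit circle. Two
    terms within [e / 4] of it on [s] are, by [unit_distD], within [2 * (e / 4) + 2 * (e / 4) = e]
    of each other. *)
Lemma dual_precompact (s : seq G) (e : R) : 0 < e -> exists Y : seq D,
  forall chi, exists2 g, g \in Y & forall x, x \in s -> 1 - re (dual_div chi g) x < e.
Proof.
move=> e0; apply: contrapT => /separated_sequence [u uP].
have [N [UN ooN]] := ultraFilterLemma eventually_filter.
have un n x : re (u n) x ^+ 2 + im (u n) x ^+ 2 = 1.
  by have [[_ _ h] _ _] := dual_rchar (u n); exact: h.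
have bnd n x : `|re (u n) x| <= 1 /\ `|im (u n) x| <= 1.
  by have [cs _ _] := dual_rchar (u n); exact: rchar_norm.
have cr x : cvg (re (u n) x @[n --> N]).
  by apply: (@ultra_cvg_bound _ _ N UN _ 1) => n; case: (bnd n x).
have ci x : cvg (im (u n) x @[n --> N]).
  by apply: (@ultra_cvg_bound _ _ N UN _ 1) => n; case: (bnd n x).
pose r x := lim (re (u n) x @[n --> N]); pose i x := lim (im (u n) x @[n --> N]).
have ri x : r x ^+ 2 + i x ^+ 2 = 1.
  have h : re (u n) x * re (u n) x + im (u n) x * im (u n) x @[n --> N] -->
      r x ^+ 2 + i x ^+ 2.
    by rewrite !expr2; apply: cvgD; apply: cvgM; [exact: cr|exact: cr|exact: ci|exact: ci].
  rewrite (_ : (fun n => _) = (fun=> 1)) in h; last first.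
    by apply/funext => n; rewrite -!expr2 un.
  exact: (cvg_unique (@Rhausdorff R) h (cvg_cst _)).
have e4 : 0 < e / 4 by lra.
have nearN : \forall n \near N, forall x, x \in s ->
    1 - (re (u n) x * r x + im (u n) x * i x) < e / 4.
  apply: near_all_seq => x _.
  have h : re (u n) x * r x + im (u n) x * i x @[n --> N] --> r x * r x + i x * i x.
    by apply: cvgD; apply: cvgMr_tmp; [exact: cr|exact: ci].
  rewrite -!expr2 ri in h.
  have /(cvgr_gt _ h) : 1 - e / 4 < (1 : R) by lra.
  by apply: filterS => n; lra.
have [a ha] := filter_ex nearN.
have Na : N [set b | (a < b)%N] by apply: ooN; exists a.+1.
have [b [hb ab]] := filter_ex (filterI nearN Na).
apply: (uP a b ab) => x xs; rewrite re_div.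
have := unit_distD (un b x) (ri x) (un a x).
by have := ha x xs; have := hb x xs; rewrite [r x * _]mulrC [i x * _]mulrC; lra.
Qed.

Section Functional.
Variable psi : D -> Torus R.
Hypothesis cpsi : continuous psi.
Hypothesis psiM : forall c1 c2 c3 : D, dual_add_rel c1 c2 c3 ->
  set_val (psi c3) = cmul (set_val (psi c1)) (set_val (psi c2)).

Let pr chi := tre (psi chi).
Let pim chi := tim (psi chi).

Let psi1 chi : pr chi ^+ 2 + pim chi ^+ 2 = 1.
Proof. exact: tre_tim. Qed.

Let psi_div a b : pr (dual_div a b) = pr a * pr b + pim a * pim b /\
  pim (dual_div a b) = pim a * pr b - pr a * pim b.
Proof.
have rel : dual_add_rel (dual_div a b) b a.
  move=> x; have [[_ _ /(_ x) hb] _ _] := dual_rchar b.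
  rewrite /cmul -/(ev a x) -/(ev b x) -/(ev (dual_div a b) x).
  rewrite -/(tre (ev b x)) -/(tim (ev b x)) -/(tre (ev (dual_div a b) x)) -/(tim (ev (dual_div a b) x)).
  rewrite (_ : set_val (ev a x) = (re a x, im a x)); last first.
    by rewrite /re /im /tre /tim; case: (set_val _).
  rewrite -/(re b x) -/(im b x) -/(re (dual_div a b) x) -/(im (dual_div a b) x) re_div im_div.
  by congr (_, _); rewrite -[LHS]mulr1 -hb; ring.
have := psiM rel; have := psi1 b; rewrite /pr /pim /tre /tim /cmul.
case: (set_val (psi a)) => a1 a2; case: (set_val (psi b)) => b1 b2.
case: (set_val (psi (dual_div a b))) => d1 d2 /= hb [-> ->].
by split; rewrite -[LHS]mulr1 -hb; ring.
Qed.

(* Real and imaginary part of the character [chi |-> chi x * psi chi]. *)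
Let A x chi := re chi x * pr chi - im chi x * pim chi.
Let B x chi := im chi x * pr chi + re chi x * pim chi.

Let AB1 x chi : A x chi ^+ 2 + B x chi ^+ 2 = 1.
Proof.
have [[_ _ /(_ x) h] _ _] := dual_rchar chi.
by rewrite -[RHS]mulr1 -{1}h -(psi1 chi) /A /B; ring.
Qed.

Let bA x : bounded_fn (A x).
Proof. by exists 1 => chi; rewrite ler_norml; have := AB1 x chi; nra. Qed.

Let bB x : bounded_fn (B x).
Proof. by exists 1 => chi; rewrite ler_norml; have := AB1 x chi; nra. Qed.

Let A_div x chi g : A x (dual_div chi g) = A x chi * A x g + B x chi * B x g.
Proof. by have [h1 h2] := psi_div chi g; rewrite /A /B h1 h2 re_div im_div; ring. Qed.

Let B_div x chi g : B x (dual_div chi g) = B x chi * A x g - A x chi * B x g.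
Proof. by have [h1 h2] := psi_div chi g; rewrite /A /B h1 h2 re_div im_div; ring. Qed.

(** The product-to-sum formula: multiplication by [re chi y] turns an evaluation into a combination
    of evaluations, so orthogonality to all of them extends to polynomials in the [re chi y]. *)
Let A_mul x y chi : re chi y * A x chi = 2^-1 * A (x + y) chi + 2^-1 * A (x - y) chi.
Proof.
have [cs _ _] := dual_rchar chi; have [h1 h2] := rcharB cs x y.
by have [cD sD _] := cs; rewrite /A h1 h2 cD sD; field.
Qed.

Let B_mul x y chi : re chi y * B x chi = 2^-1 * B (x + y) chi + 2^-1 * B (x - y) chi.
Proof.
have [cs _ _] := dual_rchar chi; have [h1 h2] := rcharB cs x y.
by have [cD sD _] := cs; rewrite /B h1 h2 cD sD; field.
Qed.

(* Otherwise [psi] is orthogonal to all evaluations, hence to the powers of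
   [p = \prod_(x <- s) (1 + re chi x) / 2]; but these concentrate where all
   [chi x], [x \in s], are close to 1, and there [pr chi > 1/2]. *)
Lemma functional_eval : exists x, forall chi, psi chi = ev chi x.
Proof.
apply: contrapT => /forallNP nev.
have [one [r1 i1]] := dual_one_ex.
have [U [UU U0 Uinv]] := @folner_ultrafilter R D one D (fun a chi => dual_div chi a)
  (fun a b chi => dual_divAC chi b a).
have inv g (k : D -> R) : bounded_fn k -> mean U (fun chi => k (dual_div chi g)) = mean U k.
  exact: (mean_invariant UU Uinv g).
(* Translation by [g] multiplies the character [A + i B] by the conjugate of its value at [g]. If
   its mean is nonzero that value is always 1, and [psi] is evaluation at [- x]. *)
have orth x : mean U (A x) = 0 /\ mean U (B x) = 0.
  have mA g : mean U (A x) = A x g * mean U (A x) + B x g * mean U (B x).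
    rewrite -[LHS](inv g) //; under eq_fun do rewrite A_div mulrC [B x _ * _]mulrC.
    by rewrite meanD ?meanZ //; apply: bounded_fnM => //; exact: bounded_fn_cst.
  have mB g : mean U (B x) = A x g * mean U (B x) - B x g * mean U (A x).
    rewrite -[LHS](inv g) //; under eq_fun do rewrite B_div mulrC [A x _ * _]mulrC.
    by rewrite meanB ?meanZ //; apply: bounded_fnM => //; exact: bounded_fn_cst.
  move: (mean U (A x)) (mean U (B x)) mA mB => a b mA mB.
  suff ab0 : a ^+ 2 + b ^+ 2 = 0.
    by move/eqP: ab0; rewrite paddr_eq0 ?sqr_ge0 // !sqrf_eq0 => /andP[/eqP -> /eqP ->].
  apply: contrapT => ab0; apply: (nev (- x)) => g.
  have A1 : A x g = 1.
    have h : (1 - A x g) * (a ^+ 2 + b ^+ 2) = 0.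
      have e1 : a * a = a * (A x g * a + B x g * b) by rewrite -mA.
      have e2 : b * b = b * (A x g * b - B x g * a) by rewrite -mB.
      have -> : (1 - A x g) * (a ^+ 2 + b ^+ 2) = a * a + b * b -
         (a * (A x g * a + B x g * b) + b * (A x g * b - B x g * a)) by ring.
      by rewrite -e1 -e2 subrr.
    by move/eqP: h; rewrite mulf_eq0 subr_eq0 => /orP[/eqP <- //|/eqP].
  have B0 : B x g = 0 by have := AB1 x g; rewrite A1; nra.
  have [cs _ _] := dual_rchar g; have [rN iN] := rcharN cs x.
  have [_ _ /(_ x) n1] := cs.
  have q1 : pr g = re g x * A x g + im g x * B x g.
    by rewrite -[LHS]mul1r -n1 /A /B; ring.
  have q2 : pim g = re g x * B x g - im g x * A x g.
    by rewrite -[LHS]mul1r -n1 /A /B; ring.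
  apply: torus_inj.
    by rewrite -/(pr g) -/(re g (- x)) rN q1 A1 B0; ring.
  by rewrite -/(pim g) -/(im g (- x)) iN q2 A1 B0; ring.
pose E (k : D -> R) := bounded_fn k /\ forall x,
  mean U (fun chi => k chi * A x chi) = 0 /\ mean U (fun chi => k chi * B x chi) = 0.
have E1 : E (fun=> 1).
  split; first exact: bounded_fn_cst.
  by move=> x; have [hA hB] := orth x; split; under eq_fun do rewrite mul1r.
have bre y : bounded_fn (fun chi : D => re chi y).
  by exists 1 => chi; have [cs _ _] := dual_rchar chi; case: (rchar_norm cs y).
have Emul k y : E k -> E (fun chi => (1 + re chi y) / 2 * k chi).
  move=> [bk Ek]; split.
    apply: bounded_fnM => //; apply: bounded_fnM; last exact: bounded_fn_cst.
    by apply: bounded_fnD => //; exact: bounded_fn_cst.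
  have gen (F : G -> D -> R) : (forall x, bounded_fn (F x)) ->
      (forall x, mean U (fun chi => k chi * F x chi) = 0) ->
      (forall x chi, re chi y * F x chi = 2^-1 * F (x + y) chi + 2^-1 * F (x - y) chi) ->
      forall x, mean U (fun chi => (1 + re chi y) / 2 * k chi * F x chi) = 0.
    move=> bF F0 Fm x.
    have bkF z : bounded_fn (fun chi => k chi * F z chi) by exact: bounded_fnM.
    have bZ z (a : R) : bounded_fn (fun chi => a * (k chi * F z chi)).
      by apply: bounded_fnM => //; exact: bounded_fn_cst.
    rewrite (_ : (fun _ => _) = (fun chi => 2^-1 * (k chi * F x chi) +
      (4^-1 * (k chi * F (x + y) chi) + 4^-1 * (k chi * F (x - y) chi)))); last first.
      apply/funext => chi.
      have -> : (1 + re chi y) / 2 * k chi * F x chi =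
        2^-1 * (k chi * F x chi) + 2^-1 * k chi * (re chi y * F x chi) by ring.
      by rewrite Fm; field.
    rewrite meanD //; last exact: bounded_fnD.
    by rewrite meanD // !meanZ // !F0 !mulr0 !addr0.
  move=> x; split; apply: gen => // z; by case: (Ek z).
have [s [e [e0 sP]]] : exists (s : seq G) (e : R), 0 < e /\
    forall chi, (forall x, x \in s -> 1 - re chi x < e) -> 2^-1 < pr chi.
  apply: (near_one_cvg r1 i1 (P := [set chi | 2^-1 < pr chi])).
  have p1 : pr one = 1.
    have [h _] := psi_div one one.
    have -> : one = dual_div one one.
      by apply: dual_ext => x; rewrite ?re_div ?im_div r1 i1; ring.
    by rewrite h -(psi1 one); ring.
  have cpr : pr chi @[chi --> one] --> pr one.
    by apply: (@continuous_comp _ _ _ psi (@tre R)); [exact: cpsi|exact: continuous_tre].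
  by apply: (cvgr_gt _ cpr); rewrite p1; lra.
wlog e1 : e e0 sP / e <= 1.
  move=> h; apply: (h (Num.min e 1)).
  - by rewrite lt_min e0 ltr01.
  - by move=> chi hs; apply: sP => x /hs; rewrite lt_min => /andP[].
  - by rewrite ge_min lexx orbT.
pose p (chi : D) : R := \prod_(x <- s) ((1 + re chi x) / 2).
have Eprod (t : seq G) k : E k -> E (fun chi => \prod_(x <- t) ((1 + re chi x) / 2) * k chi).
  move=> Ek; elim: t => [|y t IHt]; first by under eq_fun do rewrite big_nil mul1r.
  by under eq_fun do rewrite big_cons -mulrA; exact: Emul.
have Ep N : E (fun chi => p chi ^+ N).
  elim: N => [|N IH]; first by under eq_fun do rewrite expr0.
  by under eq_fun do rewrite exprS /p; exact: Eprod.
have fac (chi : D) x : 0 <= (1 + re chi x) / 2 <= 1.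
  have [cs _ _] := dual_rchar chi; have [+ _] := rchar_norm cs x.
  by rewrite ler_norml => /andP[? ?]; apply/andP; split; lra.
have p01 chi : 0 <= p chi <= 1.
  rewrite /p; elim: (s) => [|x t /andP[t0 t1]]; first by rewrite big_nil ler01 lexx.
  have /andP[f0 f1] := fac chi x.
  by rewrite big_cons mulr_ge0 // mulr_ile1.
(* One factor with [1 - re chi x >= e] already brings [p] down to [q]. Where all [1 - re chi x < d],
   each factor exceeds [1 - d / 2], and Bernoulli's inequality with the [d] below keeps [p] above
   [q']. *)
pose q := 1 - e / 2; pose q' := 1 - e / 4.
have q0 : 0 < q by rewrite /q; lra.
have qq' : q < q' by rewrite /q /q'; lra.
have pq chi x : x \in s -> e <= 1 - re chi x -> p chi <= q.
  move=> xs ex; rewrite /p (big_rem x) //=; have /andP[f0 f1] := fac chi x.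
  have r01 : 0 <= \prod_(y <- rem x s) ((1 + re chi y) / 2) <= 1.
    elim: (rem x s) => [|y t /andP[t0 t1]]; first by rewrite big_nil ler01 lexx.
    by have /andP[g0 g1] := fac chi y; rewrite big_cons mulr_ge0 // mulr_ile1.
  case/andP: r01 => r0 rl1.
  by apply: (@le_trans _ _ ((1 + re chi x) / 2)); [rewrite ler_piMr|rewrite /q; lra].
pose d := e / (2 * (size s).+1%:R).
have n0 : (0 : R) < (size s).+1%:R by rewrite ltr0n.
have d0 : 0 < d by rewrite divr_gt0 // mulr_gt0.
have de : d <= e.
  rewrite ler_pdivrMr ?mulr_gt0 // ler_peMr // ?(ltW e0) //.
  have : (1 : R) <= (size s).+1%:R by rewrite ler1n.
  by lra.
have pq' chi : (forall x, x \in s -> 1 - re chi x < d) -> q' <= p chi.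
  move=> h; have bern : forall t : seq G, {subset t <= s} ->
      1 - (size t)%:R * (d / 2) <= \prod_(x <- t) ((1 + re chi x) / 2).
    elim=> [|x t IH] ts; first by rewrite big_nil mul0r subr0.
    have /IH {}IH : {subset t <= s} by move=> y yt; apply: ts; rewrite in_cons yt orbT.
    have hx := h x (ts x (mem_head _ _)); have /andP[f0 f1] := fac chi x.
    have t01 : \prod_(x <- t) ((1 + re chi x) / 2) <= 1.
      elim: (t) => [|y t' t1]; first by rewrite big_nil.
      have /andP[g0 g1] := fac chi y; rewrite big_cons mulr_ile1 //.
      by apply: prodr_ge0 => z _; case/andP: (fac chi z).
    rewrite big_cons /= -natr1 mulrDl mul1r.
    move: IH t01; set P := \prod_(x <- t) _; set S := (size t)%:R * _ => IH t01.
    have : (1 + re chi x) / 2 * P = P - (1 - re chi x) / 2 * P by field.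
    have : (1 - re chi x) / 2 * P <= (1 - re chi x) / 2.
      by rewrite ler_piMr //; lra.
    by lra.
  apply: le_trans (bern s (fun x xs => xs)); rewrite /q' lerD2l lerN2.
  have sn : (size s)%:R <= (size s).+1%:R :> R by rewrite ler_nat.
  have -> : e / 4 = (size s).+1%:R * (d / 2).
    by rewrite /d; field; rewrite /= addrC natr1 gt_eqF.
  by rewrite ler_pM2r // divr_gt0.
pose Q (chi : D) := forall x, x \in s -> 1 - re chi x < d.
pose ind (chi : D) : R := (`[< Q chi >])%:R.
have bind : bounded_fn ind.
  by exists 1 => chi; rewrite /ind; case: asboolP => _; rewrite ?normr1 ?normr0.
have ind0 chi : 0 <= ind chi by rewrite /ind ler0n.
have [Y YP] := dual_precompact s d0.
have m0 : 0 < mean U ind.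
  have b g : bounded_fn (fun chi => ind (dual_div chi g)) by exact: bounded_fn_comp.
  have h : 1 <= mean U (fun chi => \sum_(g <- Y) ind (dual_div chi g)).
    rewrite -[X in X <= _](mean_cst UU U0); apply: mean_le => //.
    - exact: bounded_fn_cst.
    - exact: bounded_fn_sum.
    move=> chi; have [g gY hg] := YP chi; rewrite (big_rem g) //=.
    have -> : ind (dual_div chi g) = 1 by rewrite /ind asboolT.
    by rewrite lerDl sumr_ge0.
  rewrite lt_def mean_ge0 // andbT; apply/negP => /eqP z.
  move: h; rewrite mean_sum //.
  under eq_bigr do rewrite inv // z.
  by rewrite big1_eq leNgt ltr01.
(* The function [p ^+ N * pr] has mean 0. It is at least [2^-1 * q' ^+ N] on [Q], nonnegative where
   all [1 - re chi x < e], and at least [- q ^+ N] elsewhere. As [q < q'], the resulting inequality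
   fails for large [N]. *)
have key N : 2^-1 * q' ^+ N * mean U ind <= q ^+ N.
  have [bp Epx] := Ep N.
  have z : mean U (fun chi => p chi ^+ N * pr chi) = 0.
    have [+ _] := Epx 0; rewrite /A; under eq_fun => chi.
      have [cs _ _] := dual_rchar chi; have [-> ->] := rchar0 cs.
      rewrite mul1r mul0r subr0; over.
    by [].
  have bpr : bounded_fn pr.
    by exists 1 => chi; rewrite ler_norml; have := psi1 chi; nra.
  have bi : bounded_fn (fun chi => 2^-1 * q' ^+ N * ind chi).
    by apply: bounded_fnM => //; exact: bounded_fn_cst.
  rewrite -meanZ // -subr_ge0 -[X in X - _](mean_cst UU U0 (q ^+ N)) -meanB //; last exact: bounded_fn_cst.
  rewrite -oppr_le0 -[X in _ <= X]z -meanN; last by apply: bounded_fnB => //; exact: bounded_fn_cst.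
  apply: mean_le.
  - by apply: bounded_fnN; apply: bounded_fnB => //; exact: bounded_fn_cst.
  - exact: bounded_fnM.
  move=> chi; have /andP[p0 p1] := p01 chi.
  have qN : 0 <= q ^+ N by rewrite exprn_ge0 // ltW.
  have pN : 0 <= p chi ^+ N by rewrite exprn_ge0.
  have pr1 : -1 <= pr chi by have := psi1 chi; nra.
  rewrite /ind; case: asboolP => /= [Qchi|nQ]; rewrite ?mulr1 ?mulr0 ?subr0.
    have h1 : 2^-1 < pr chi by apply: sP => x /Qchi hx; exact: lt_le_trans hx de.
    have h2 : q' ^+ N <= p chi ^+ N.
      by apply: lerXn2r; rewrite ?nnegrE ?(le_trans (ltW q0) (ltW qq')) // pq'.
    by nra.
  have [h|] := pselect (forall x, x \in s -> 1 - re chi x < e).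
    by have := sP chi h; nra.
  move=> /existsNP [x /not_implyP [xs /negP]]; rewrite -leNgt => ex.
  have h2 : p chi ^+ N <= q ^+ N.
    by apply: lerXn2r; rewrite ?nnegrE ?(ltW q0) // (pq chi x).
  by nra.
have q'0 := lt_trans q0 qq'.
have cvg0 : (q / q') ^+ N @[N --> \oo] --> (0 : R).
  by apply: cvg_expr; rewrite ger0_norm ?divr_ge0 ?ltW // ltr_pdivrMr // mul1r.
have m2 : 0 < 2^-1 * mean U ind by rewrite mulr_gt0.
have /(cvgr_lt _ cvg0) [n _ /(_ n (leqnn n)) /=] := m2.
rewrite expr_div_n ltr_pdivrMr ?exprn_gt0 // => lt.
by have := key n; rewrite mulrAC leNgt lt.
Qed.

End Functional.

End BidualEval.

(** * Reflexivity of the group *)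

Theorem theorem6p1 (R : realType) (G : topologicalZmodType) :
  hausdorff_space G ->
  pseudocompact R G ->
  (forall K : set G, compact K -> finite_set K) ->
  pontryagin_reflexive R G.
Proof.
move=> hG pcG finK; have preG := pseudocompact_precompact pcG.
have bohr (x : G) (V : set G) : nbhs x V -> exists (s : seq (Dual R G)) (e : R), 0 < e /\
    forall y, (forall chi, chi \in s -> 1 - re chi (y - x) < e) -> V y.
  move=> /nbhs_addl /(@precompact_bohr R G _ preG) [s [e [e0 sP sV]]].
  have /choice [f fP] : forall p : (G -> R) * (G -> R), exists chi : Dual R G,
      cont_rchar p.1 p.2 -> re chi = p.1.
    move=> p; have [/rchar_dual [chi [? _]]|np] := pselect (cont_rchar p.1 p.2).
      by exists chi.
    by have [one _] := dual_one_ex R G; exists one.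
  exists (map f s), e; split => // y yP.
  have -> : y = x + (y - x) by rewrite addrC subrK.
  by apply: sV => p ps; rewrite -(fP p (sP p ps)); apply: yP; exact: map_f.
have aP x : (alpha R G x : {compact-open, Dual R G -> Torus R}) \in bidual_set R G.
  apply: mem_set; split; first exact: continuous_ev.
  by move=> c1 c2 c3 /(_ x).
pose a x : Bidual R G := SigSub (aP x).
have /choice [b bP] : forall p : Bidual R G, exists x, forall chi : Dual R G, ev p chi = ev chi x.
  move=> p; have [cp pM] := set_valP p.
  exact: (functional_eval finK cp pM).
have ba : cancel b a by move=> p; apply: val_inj; apply/funext => chi; exact: esym (bP p chi).
(* No continuous character separates [b (a x)] from [x], so by [bohr] every neighbourhood of
   [b (a x)] contains [x], and the Hausdorff property identifies them. *)
have ab : cancel a b.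
  move=> x; apply: hG => A B Ab Bx; exists x; split; last exact: nbhs_singleton Bx.
  have [s [e [e0 sA]]] := bohr _ _ Ab; apply: sA => chi _.
  have [cs _ _] := dual_rchar chi.
  have bx : ev chi (b (a x)) = ev chi x by rewrite -bP.
  rewrite (proj1 (rcharB cs _ _)) /re /im bx -!expr2 tre_tim; lra.
have ca : continuous a.
  move=> x; apply: cvg_compact_open => [K|chi]; first exact: compact_dual_finite.
  by have [cchi _] := set_valP chi; exact: cchi.
exists a; split => //; split.
  by move=> x y chi; have [_] := set_valP chi; apply.
split; first by exists b.
(* For the continuity of [b]: [bohr] describes neighbourhoods of [b p] by finitely many [chi], and
   the value of [chi] at [b q] is that of [q] at [chi], continuous in [q]. *)
split => //; exists b; split => //; split => // p V /bohr [s [e [e0 sV]]].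
have : \forall q \near p, forall chi, chi \in s -> 1 - re chi (b q - b p) < e.
  apply: (@near_all_seq _ _ (nbhs p) (nbhs_filter p) s) => chi _.
  have [cs _ _] := dual_rchar chi.
  have ctre : tre (ev q chi) @[q --> p] --> tre (ev p chi).
    apply: (@continuous_comp _ _ _ (fun q : Bidual R G => ev q chi) (@tre R)).
      exact: continuous_ev.
    exact: continuous_tre.
  have ctim : tim (ev q chi) @[q --> p] --> tim (ev p chi).
    apply: (@continuous_comp _ _ _ (fun q : Bidual R G => ev q chi) (@tim R)).
      exact: continuous_ev.
    exact: continuous_tim.
  have cre : re chi (b q - b p) @[q --> p] --> (1 : R).
    have reE q : re chi (b q - b p) =
        tre (ev q chi) * tre (ev p chi) + tim (ev q chi) * tim (ev p chi).
      by rewrite (proj1 (rcharB cs _ _)) /re /im -!bP.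
    rewrite (funext reE) -(tre_tim (ev p chi)) !expr2.
    exact: (@cvgD _ _ _ _ (nbhs_filter p) _ _ _ _
      (@cvgMr_tmp _ _ _ (nbhs_filter p) _ _ _ ctre)
      (@cvgMr_tmp _ _ _ (nbhs_filter p) _ _ _ ctim)).
  have /(cvgr_gt _ cre) : 1 - e < (1 : R) by lra.
  by apply: filterS => q /=; lra.
by apply: filterS => q /sV.
Qed.
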